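(* Let $G$ be a plane graph and let $e = v_1v_2$ be a boundary edge of $G$. Then there exists an index function $\eta$ of $G - e$ such that: (i) $c_{G-e,\eta} \neq 0$; (ii) $\eta(v_1) = \eta(v_2) = 0$, $\eta(v) \le 2$ for every boundary vertex $v \notin \{v_1, v_2\}$, and $\eta(v) \le 4$ for every interior vertex $v$. (Such an $\eta$ is called a nice index function for $(G,e)$.)
   Context: A plane graph is a finite simple graph embedded in the plane. Boundary vertices and boundary edges are those lying on the outer (unbounded) face; all other vertices are interior vertices. For a graph $H$, associate to each vertex $v$ a variable $x_v$, fix an arbitrary linear ordering $<$ of $V(H)$, and let $P_H(\vec{x}) = \prod_{uv \in E(H),\, u<v} (x_v - x_u)$. An index function $\eta$ of $H$ assigns to each vertex $v$ (equivalently, each variable $x_v$) a non-negative integer $\eta(v)$; $c_{H,\eta}$ denotes the coefficient of the monomial $\prod_v x_v^{\eta(v)}$ in the expansion of $P_H(\vec{x})$. Here $H = G - e$ has the same vertex set as $G$. *)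

(* Defs.v *)
From HB Require Import structures.
From mathcomp Require Import all_boot all_order all_algebra.
From mathcomp Require Import all_classical all_reals topology normedtype.
From mathcomp Require mpoly.
(* Only the structure instances are imported: the notations of mpoly clash with
   those of MathComp-Analysis. *)
Import (canonicals) mpoly.
Import Order.TTheory GRing.Theory Num.Theory.
Import numFieldNormedType.Exports.

Set Implicit Arguments.
Unset Strict Implicit.
Unset Printing Implicit Defensive.

Local Open Scope classical_set_scope.
Local Open Scope ring_scope.

Definition is_arc (R : realType) (p q : R * R) (A : set (R * R)) : Prop :=
  exists gamma : R -> R * R,
    [/\ {within `[0, 1], continuous gamma},
        {in `[0, 1] &, injective gamma},
        gamma 0 = p, gamma 1 = q & gamma @` `[0, 1] = A].

(* A finite simple graph on V together with an embedding in the plane: the edge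
   uv is drawn as the set [edge_curve u v], which is meaningful only when
   [adj u v] holds. By [curve_vertex], the points of [range pos] that two edge
   curves share in [curve_disjoint] are images of common ends of the edges. *)
Record plane_graph (R : realType) (V : finType) : Type := PlaneGraph {
  adj : rel V;
  adj_sym : symmetric adj;
  adj_irr : irreflexive adj;
  pos : V -> R * R;
  edge_curve : V -> V -> set (R * R);
  pos_inj : injective pos;
  curve_sym : forall u v, adj u v -> edge_curve u v = edge_curve v u;
  curve_arc : forall u v, adj u v -> is_arc (pos u) (pos v) (edge_curve u v);
  curve_vertex : forall u v w,
    adj u v -> edge_curve u v (pos w) -> w = u \/ w = v;
  curve_disjoint : forall u v u' v', adj u v -> adj u' v' ->
    ~ (u = u' /\ v = v') -> ~ (u = v' /\ v = u') ->
    edge_curve u v `&` edge_curve u' v' `<=` range pos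
}.

Section Boundary.
Variables (R : realType) (V : finType) (G : plane_graph R V).

Definition drawing : set (R * R) :=
  range (pos G) `|`
  [set x | exists u v : V, adj G u v /\ edge_curve G u v x].

(* The faces are the connected components of the complement of the drawing. As
   the drawing is compact, exactly one of them is unbounded. *)
Definition outer_face : set (R * R) :=
  [set x | (~` drawing) x /\
           ~ bounded_set (connected_component (~` drawing) x)].

Definition boundary_vertex (v : V) : Prop := closure outer_face (pos G v).

Definition interior_vertex (v : V) : Prop := ~ boundary_vertex v.

Definition boundary_edge (u v : V) : Prop :=
  adj G u v /\ edge_curve G u v `<=` closure outer_face.

End Boundary.

Definition del_edge (V : finType) (e : rel V) (v1 v2 : V) : rel V :=
  fun u v => e u v && ~~ ((u == v1) && (v == v2) || (u == v2) && (v == v1)).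

Section GraphPolynomial.
Variables (d : Order.disp_t) (V : finOrderType d) (e : rel V).

(* The variables of {mpoly int[#|V|]} are indexed by 'I_#|V|; the vertex v is
   identified with its rank [enum_rank v]. *)
Definition vertex_var (v : V) : mpoly.mpoly #|V| int :=
  mpoly.mpolyX int (mpoly.mnm1 (enum_rank v)).

Definition graph_poly : mpoly.mpoly #|V| int :=
  \prod_(p : V * V | e p.1 p.2 && (p.1 < p.2)%O)
    (vertex_var p.2 - vertex_var p.1).

Definition graph_coef (eta : V -> nat) : int :=
  mpoly.mcoeff (mpoly.Multinom [tuple eta (enum_val i) | i < #|V|]) graph_poly.

End GraphPolynomial.

(* Main.v *)
(** A vertex [z] placed in the outer face and joined to all boundary vertices
    gives a graph [H] without [K5] or [K33] minor, and the absence of these minors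
    is all that is needed of planarity.

    No minors. Replace every edge by a chain of points with short steps, chains of
    disjoint edges staying far apart. For disjoint edges [e] and [f], the map
    [(s, t) |-> e s - f t] avoids the origin, so it crosses a fixed half-line an
    even number of times along the boundary of the square. Summing over all pairs
    of disjoint edges of [K5] (or [K33]), every side of a square is counted twice,
    up to the antipodal map, whose contribution is odd in total: a contradiction.

    Index functions. Induct on pairs [(Z, S)] where [Z] is a connected set of
    vertices in the role of [z], and [S] the set of vertices still to be treated;
    the boundary of [S] is the set of vertices of [S] adjacent to [Z]. If two
    adjacent boundary vertices separate [S], the index functions of the two parts
    are added. Otherwise excluding the minors yields a boundary vertex [v] other
    than [v1], [v2] with few boundary neighbours; it is moved from [S] to [Z], and
    its edges are shared out so that a nonzero coefficient survives. *)

Require Import Defs.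
From mathcomp Require Import all_boot all_order all_algebra.
From mathcomp Require Import zify lra.
From mathcomp Require Import boolp.
From mathcomp Require mpoly.
Import (canonicals) mpoly.
Import Order.TTheory GRing.Theory Num.Theory.

Set Implicit Arguments.
Unset Strict Implicit.
Unset Printing Implicit Defensive.

(** * Coefficients of edge lists *)

Section EdgeListCoefficient.
Variable V : finType.
Implicit Types (eta xi : V -> nat) (L s : seq (V * V)) (u v w : V).

(** Keeping [Z] as a set turns moving [v] from [S] to [Z] into a contraction that needs no new
    graph: all minors are sought in one fixed graph, as families of connected sets. The bounds come
    from this move: every neighbour of [v] in [S] then sees [Z], so its exponent is at most 2, and
    it may receive up to 2 more if it does not see the old [Z]. The obstacle is cancellation, since
    an exponent at [v] can arise from several choices with signs. Exponent 0 leaves one choice;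
    where it would overload a boundary neighbour, exponent 1 is tried, and if its coefficient
    vanishes, another one cannot. In the plane, the obstacle is that a point in the closure of the
    outer face is not obviously the end of an arc inside that face. Chains of short steps exist in
    every connected set, and may leave the face close to the boundary vertex. *)

Definition decr eta v : V -> nat := fun x => eta x - (x == v).
Definition incr eta v : V -> nat := fun x => eta x + (x == v).
Definition incrs eta (U : seq V) : V -> nat := fun x => eta x + count_mem x U.

(* The coefficient of [\prod_x X_x ^+ eta x] in the product of the factors
   [X_v - X_u] over the pairs [(u, v)] of the list. *)
Fixpoint coef L eta : int :=
  if L is (u, v) :: s then
    ((if (0 < eta v)%N then coef s (decr eta v) else 0)
     - (if (0 < eta u)%N then coef s (decr eta u) else 0))%R
  else (([forall x, eta x == 0]) : nat)%:R%R.

Lemma incrK v : cancel (incr^~ v) (decr^~ v).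
Proof. by move=> eta; apply: funext => x; rewrite /decr /incr addnK. Qed.

Lemma decrD eta xi v : xi v = 0 ->
  decr (fun x => eta x + xi x) v = (fun x => decr eta v x + xi x).
Proof.
by move=> h; apply: funext => x; rewrite /decr; case: eqP => [->|_]; lia.
Qed.

Lemma incr_gt0 eta v : 0 < incr eta v v.
Proof. by rewrite /incr eqxx addn1. Qed.

Lemma incrs_nil eta : incrs eta [::] = eta.
Proof. by apply: funext => x; rewrite /incrs addn0. Qed.

Lemma incrs_cons eta u U : incrs eta (u :: U) = incr (incrs eta U) u.
Proof. by apply: funext => x; rewrite /incrs /incr /= [u == x]eq_sym; lia. Qed.

Lemma incr_incrs eta u U : incr (incrs eta U) u = incrs (incr eta u) U.
Proof. by apply: funext => x; rewrite /incrs /incr; lia. Qed.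

Lemma incrC eta u v : incr (incr eta u) v = incr (incr eta v) u.
Proof. by apply: funext => x; rewrite /incr; lia. Qed.

Lemma incrs_notin eta U x : x \notin U -> incrs eta U x = eta x.
Proof. by rewrite /incrs => /count_memPn ->; rewrite addn0. Qed.

Lemma sum_decr eta v : 0 < eta v -> \sum_x eta x = (\sum_x decr eta v x).+1.
Proof.
move=> h; rewrite (bigD1 v) //= [in RHS](bigD1 v) //= /decr eqxx.
rewrite (eq_bigr (fun x => eta x - (x == v))); first by lia.
by move=> x /negbTE ->; rewrite subn0.
Qed.

Lemma coef_size L eta : coef L eta <> 0%R -> \sum_x eta x = size L.
Proof.
elim: L eta => [|[u v] s IH] eta /=.
  case: forallP => // h _; rewrite big1 // => x _; exact/eqP.
case: ifP => [v0|_]; case: ifP => [u0|_]; rewrite ?subr0 ?sub0r //.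
- have [e0|/eqP ne0] := eqVneq (coef s (decr eta v)) 0%R.
    rewrite e0 sub0r => h; rewrite (sum_decr u0) IH // => e1; apply: h.
    by rewrite e1 oppr0.
  by move=> _; rewrite (sum_decr v0) IH.
- by move=> h; rewrite (sum_decr v0) IH.
- by move=> h; rewrite (sum_decr u0) IH // => e1; apply: h; rewrite e1 oppr0.
Qed.

Definition avoids L v := all (fun p => (p.1 != v) && (p.2 != v)) L.

Lemma coef_avoids L eta v : avoids L v -> coef L eta <> 0%R -> eta v = 0.
Proof.
elim: L eta => [|[u w] s IH] eta /=.
  by case: forallP => // h _ _; apply/eqP.
move=> /andP[/andP[uv wv] sv].
have dE x : x != v -> decr eta x v = eta v.
  by rewrite /decr eq_sym => /negbTE ->; rewrite subn0.
case: ifP => [w0|_]; case: ifP => [u0|_]; rewrite ?subr0 ?sub0r //.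
- have [e0|/eqP ne0] := eqVneq (coef s (decr eta w)) 0%R.
    rewrite e0 sub0r => h; rewrite -(dE u) // IH // => e1; apply: h.
    by rewrite e1 oppr0.
  by move=> _; rewrite -(dE w) // IH.
- by move=> h; rewrite -(dE w) // IH.
- by move=> h; rewrite -(dE u) // IH // => e1; apply: h; rewrite e1 oppr0.
Qed.

(** Using up the factors of [L1] leaves [xi] untouched, and the nonzero coefficient of [L2] fixes
    the total degree; so whatever is left of [eta] must be 0. The lists may share vertices, as long
    as [xi] is 0 there. *)
Lemma coef_cat L1 L2 eta xi :
    (forall p, p \in L1 -> xi p.1 = 0 /\ xi p.2 = 0) ->
    coef L2 xi <> 0%R ->
  coef (L1 ++ L2) (fun x => eta x + xi x) = (coef L1 eta * coef L2 xi)%R.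
Proof.
move=> + nz; elim: L1 eta => [|[u v] s IH] eta hL /=.
  case: forallP => [h|h].
    rewrite mul1r; congr coef; apply: funext => x.
    by rewrite (eqP (h x)).
  rewrite mul0r; apply/eqP/negPn/negP => /eqP /coef_size.
  rewrite big_split /= (coef_size nz) => e.
  apply: h => x; apply/eqP.
  have : \sum_x eta x = 0 by lia.
  by move/eqP; rewrite sum_nat_eq0 => /forallP /(_ x) /eqP.
have [/= xu xv] := hL _ (mem_head _ _).
have hs p : p \in s -> xi p.1 = 0 /\ xi p.2 = 0.
  by move=> ps; apply: hL; rewrite inE ps orbT.
rewrite xu xv !addn0 !decrD // !IH // mulrBl.
by case: ifP; case: ifP; rewrite ?mul0r.
Qed.

Definition star v (U : seq V) : seq (V * V) := [seq (v, u) | u <- U].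

(** With exponent 0 at [v], each factor of the star can only contribute its other end, with sign
    plus, so nothing cancels. *)
Lemma coef_push v U L eta : v \notin U -> eta v = 0 ->
  coef (star v U ++ L) (incrs eta U) = coef L eta.
Proof.
move=> vU ev; elim: U vU => [|u U IH] /=; first by rewrite incrs_nil.
rewrite inE negb_or => /andP[vu vU].
rewrite (@incrs_notin _ _ v) ?inE ?negb_or ?vu // ev /= subr0.
by rewrite incrs_cons incr_gt0 incrK IH.
Qed.

(* Exponent 1 at [v] means that exactly one edge of the star contributes [v]. *)
Lemma coef_push1 v U L eta : v \notin U -> avoids L v -> eta v = 0 ->
  coef (star v U ++ L) (incr (incrs eta U) v) <> 0%R ->
  exists2 u, u \in U & coef L (incr eta u) <> 0%R.
Proof.
move=> vU av ev; elim: U vU => [|u U IH] /=.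
  by rewrite incrs_nil => _ /(coef_avoids av); rewrite /incr eqxx addn1.
rewrite inE negb_or => /andP[vu vU].
have vu' : u == v = false by rewrite eq_sym (negbTE vu).
rewrite incr_gt0 incrK incrs_cons incrC incr_gt0 incrK.
rewrite [incr (incrs eta U) u]incr_incrs coef_push //; last by rewrite /incr ev (negbTE vu).
have [e0|/eqP ne0] := eqVneq (coef L (incr eta u)) 0%R.
  rewrite e0 subr0 => /(IH vU) [x xU h]; exists x => //.
  by rewrite inE xU orbT.
by move=> _; exists u => //; rewrite inE eqxx.
Qed.

Lemma coef_fix a v L eta : a != v -> eta a = 0 ->
  coef ((a, v) :: L) (incr eta v) = coef L eta.
Proof.
move=> av ea /=; rewrite incr_gt0 incrK {1}/incr ea (negbTE av) /= subr0 //.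
Qed.

(** The direction of an edge affects only the sign of the coefficient, so it is left free. *)
Definition edge_list (r : rel V) L :=
  [/\ uniq L, forall u v, (u, v) \in L -> (v, u) \notin L &
      forall u v, r u v = ((u, v) \in L) || ((v, u) \in L)].

Lemma edge_list_sym r L u v : edge_list r L -> r u v = r v u.
Proof. by case=> _ _ h; rewrite !h orbC. Qed.

Lemma edge_list_cons r r' L u v :
    edge_list r' L -> ~~ r' u v -> u != v ->
    (forall x y, r x y = r' x y || ((x == u) && (y == v))
                         || ((x == v) && (y == u))) ->
  edge_list r ((u, v) :: L).
Proof.
move=> [uL aL eL] nr uv hr; move: nr; rewrite eL negb_or => /andP[n1 n2].
split=> [|x y|x y].
- by rewrite /= n1.
- rewrite !inE => /orP[/eqP[-> ->]|xy].
    by rewrite negb_or n2 andbT xpair_eqE negb_and uv orbT.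
  rewrite negb_or aL // andbT; apply: contra n2 => /eqP[<- <-] //.
- rewrite hr eL !inE !xpair_eqE [(y == u) && _]andbC.
  by do ![case: eqP => _ //=]; rewrite ?orbT ?orbF.
Qed.

Lemma edge_list_cat r r1 r2 L1 L2 :
    edge_list r1 L1 -> edge_list r2 L2 ->
    (forall x y, r1 x y -> ~~ r2 x y) ->
    (forall x y, r x y = r1 x y || r2 x y) ->
  edge_list r (L1 ++ L2).
Proof.
move=> [u1 a1 e1] [u2 a2 e2] dis hr.
have d p : p \in L1 -> p \notin L2.
  case: p => x y p1; have := dis x y; rewrite e1 p1 e2 => /(_ isT).
  by rewrite negb_or => /andP[].
have d' x y : (x, y) \in L1 -> (y, x) \notin L2.
  move=> p1; have := dis x y; rewrite e1 p1 e2 => /(_ isT).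
  by rewrite negb_or => /andP[].
split=> [|x y|x y].
- rewrite cat_uniq u1 u2 andbT /=; apply/hasPn => p p2.
  by apply/negP => /d; rewrite p2.
- rewrite !mem_cat negb_or => /orP[h|h].
    by rewrite a1 //= d'.
  by rewrite a2 // andbT; apply/negP => /d'; rewrite h.
- by rewrite hr e1 e2 !mem_cat; do ![case: (_ \in _)].
Qed.

Lemma edge_list_star r v (U : seq V) : uniq U -> v \notin U ->
    (forall x y, r x y = ((x == v) && (y \in U)) || ((y == v) && (x \in U))) ->
  edge_list r (star v U).
Proof.
move=> uU vU hr.
have ms x y : ((x, y) \in star v U) = (x == v) && (y \in U).
  apply/mapP/andP => [[u uu [-> ->]]|[/eqP -> yU]]; first by rewrite eqxx.
  by exists y.
split=> [|x y|x y].
- by rewrite map_inj_uniq // => a b [].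
- rewrite !ms => /andP[/eqP -> yU]; rewrite negb_and; apply/orP; left.
  by apply: contraNneq vU => <-.
- by rewrite hr !ms.
Qed.

End EdgeListCoefficient.

(** * From edge lists to the graph polynomial *)

Section EdgeListPolynomial.
Variables (d : Order.disp_t) (V : finOrderType d).
Implicit Types (L : seq (V * V)) (eta : V -> nat).

Definition eta_mnm eta : mpoly.multinom #|V| :=
  mpoly.Multinom [tuple eta (enum_val i) | i < #|V|].

Lemma eta_mnmE eta v : mpoly.fun_of_multinom (eta_mnm eta) (enum_rank v) = eta v.
Proof. by rewrite mpoly.multinomE tnth_mktuple enum_rankK. Qed.

Definition edge_poly L : mpoly.mpoly #|V| int :=
  (\prod_(p <- L) (vertex_var p.2 - vertex_var p.1))%R.

Lemma mcoeff_varM (p : mpoly.mpoly #|V| int) eta v :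
  mpoly.mcoeff (eta_mnm eta) (vertex_var v * p)%R =
  if (0 < eta v)%N then mpoly.mcoeff (eta_mnm (decr eta v)) p else 0%R.
Proof.
rewrite mulrC; case: ifP => h.
  have -> : eta_mnm eta =
      mpoly.mnm_add (mpoly.mnm1 (enum_rank v)) (eta_mnm (decr eta v)).
    apply/mpoly.mnmP => i; rewrite mpoly.mnmDE mpoly.mnm1E.
    rewrite -[i]enum_valK !eta_mnmE (inj_eq enum_rank_inj) /decr eq_sym.
    by case: eqP => [->|_]; lia.
  by rewrite mpoly.mcoeffMX.
apply/eqP; rewrite mpoly.mcoeff_eq0; apply/negP.
rewrite (perm_mem (mpoly.msuppMX _ _)) => /mapP[m _].
move=> /(congr1 (fun m : mpoly.multinom _ =>
  mpoly.fun_of_multinom m (enum_rank v))).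
by rewrite eta_mnmE mpoly.mnmDE mpoly.mnm1E eqxx => e; move: h; rewrite e.
Qed.

Lemma mcoeff_edge_poly L eta :
  mpoly.mcoeff (eta_mnm eta) (edge_poly L) = coef L eta.
Proof.
elim: L eta => [|[u v] s IH] eta /=; rewrite /edge_poly.
  rewrite big_nil mpoly.mcoeff1; congr (nat_of_bool _)%:R%R.
  apply/eqP/forallP => [e x|h].
    by rewrite -(eta_mnmE eta) e mpoly.mnm0E.
  apply/mpoly.mnmP => i; rewrite -[i]enum_valK eta_mnmE mpoly.mnm0E.
  exact/eqP.
rewrite big_cons mulrBl mpoly.mcoeffB !mcoeff_varM.
by rewrite -!IH.
Qed.

(** Each pair directed against the order of [V] costs one change of sign; [nrm] turns such pairs
    round. *)
Lemma edge_poly_graph_poly (r : rel V) L : edge_list r L ->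
  exists b : bool, edge_poly L = ((-1) ^+ b * graph_poly r)%R.
Proof.
move=> [uL aL eL].
pose nrm (p : V * V) := if (p.1 < p.2)%O then p else (p.2, p.1).
have [b eb] : exists b : bool, edge_poly L = ((-1) ^+ b * edge_poly (map nrm L))%R.
  elim: L {uL aL eL} => [|[u v] s [b IH]]; first by exists false; rewrite mul1r.
  rewrite /edge_poly /= !big_cons -/(edge_poly s) -/(edge_poly (map nrm s)) IH.
  rewrite {2 3}/nrm /=; case: ifP => _ /=.
    by exists b; rewrite mulrCA.
  exists (~~ b); rewrite -[(vertex_var v - _)%R]opprB mulNr mulrCA -mulNr.
  by congr (_ * _)%R; case: b {IH}; rewrite ?opprK.
exists b; rewrite eb; congr (_ * _)%R.
rewrite /edge_poly /graph_poly -[RHS]big_filter.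
apply: perm_big; apply: uniq_perm.
- rewrite map_inj_in_uniq // => -[x y] [x' y'] p1 p2; rewrite /nrm /=.
  case: ifP => _; case: ifP => _ // [? ?]; subst => //.
    by have := aL _ _ p1; rewrite p2.
  by have := aL _ _ p1; rewrite p2.
- by rewrite filter_uniq // index_enum_uniq.
move=> [x y]; rewrite mem_filter mem_index_enum andbT /= eL.
apply/mapP/andP => [[[u v] p]|[h xy]]; rewrite /nrm /=.
  case: ifP => [uv [-> ->]|uv [-> ->]]; first by rewrite p uv.
  rewrite p orbT; split=> //; rewrite lt_neqAle leNgt uv andbT.
  by apply/eqP => e; subst; have := aL _ _ p; rewrite p.
case/orP: h => h; [exists (x, y) => //|exists (y, x) => //] => /=.
  by rewrite xy.
by rewrite ltNge (ltW xy).
Qed.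

Lemma graph_coef_neq0 (r : rel V) L eta :
  edge_list r L -> coef L eta <> 0%R -> graph_coef r eta <> 0%R.
Proof.
move=> /edge_poly_graph_poly[b e].
rewrite -mcoeff_edge_poly e /graph_coef -/(eta_mnm eta).
case: b {e}; last by rewrite mul1r.
by rewrite mulN1r mpoly.mcoeffN => h e; apply: h; rewrite e oppr0.
Qed.

End EdgeListPolynomial.

(** * Minors *)

Ltac split_andb :=
  rewrite /=; repeat match goal with |- is_true (_ && _) => apply/andP; split end;
  rewrite ?andbT //.

Lemma uniq_two_arcs (T : eqType) (a b : T) p q : uniq (a :: p ++ b :: q) ->
  [/\ a \notin p, a \notin q, b \notin p, b \notin q & forall x, x \in p -> x \notin q].
Proof.
rewrite /= mem_cat inE !negb_or cat_uniq /= negb_or.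
move=> /andP[/and3P[ap _ aq] /and3P[_ /andP[bp /hasPn h] /andP[bq _]]].
by split=> // x xp; apply/negP => /h; rewrite xp.
Qed.

Section Minors.
Variables (W : finType) (e : rel W).
Hypotheses (eC : symmetric e) (eirr : irreflexive e).
Implicit Types (A B D F K S Z : {set W}) (x y z u v w : W).

Definition adjs A B := [exists a in A, exists b in B, e a b].
Definition restr A : rel W := fun x y => [&& x \in A, y \in A & e x y].
Definition conn A :=
  (A != set0) && [forall x in A, forall y in A, connect (restr A) x y].

(** The branch sets of a [K5] minor; in this form no contracted graph has to be built. *)
Definition K5_model (s : seq {set W}) :=
  [&& size s == 5, all conn s, pairwise (fun A B => [disjoint A & B]) s
    & pairwise adjs s].

Definition K33_model (s t : seq {set W}) :=
  [&& size s == 3, size t == 3, all conn (s ++ t),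
      pairwise (fun A B => [disjoint A & B]) (s ++ t) & allrel adjs s t].

Lemma adjsP A B :
  reflect (exists a b, [/\ a \in A, b \in B & e a b]) (adjs A B).
Proof.
apply: (iffP exists_inP) => [[a aA /exists_inP[b bB ab]]|[a [b [aA bB ab]]]].
  by exists a, b.
by exists a => //; apply/exists_inP; exists b.
Qed.

Lemma adjsC A B : adjs A B = adjs B A.
Proof.
by apply/adjsP/adjsP => -[a [b [aA bB ab]]]; exists b, a; rewrite eC.
Qed.

Lemma adjsS A B A' B' : A \subset A' -> B \subset B' -> adjs A B -> adjs A' B'.
Proof.
move=> /subsetP sA /subsetP sB /adjsP[a [b [aA bB ab]]].
by apply/adjsP; exists a, b; rewrite sA // sB.
Qed.

Lemma adjs_in A B a b : a \in A -> b \in B -> e a b -> adjs A B.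
Proof. by move=> *; apply/adjsP; exists a, b. Qed.

Lemma adjs1 x y : adjs [set x] [set y] = e x y.
Proof.
apply/adjsP/idP => [[a [b [/set1P -> /set1P -> //]]]|xy].
by exists x, y; rewrite !inE.
Qed.

Lemma restr_sym A : symmetric (restr A).
Proof. by move=> x y; rewrite /restr eC andbCA. Qed.

Lemma connect_restrC A x y : connect (restr A) x y = connect (restr A) y x.
Proof. exact/sym_connect_sym/restr_sym. Qed.

Lemma connect_restrS A B x y :
  A \subset B -> connect (restr A) x y -> connect (restr B) x y.
Proof.
move=> /subsetP sAB; apply: connect_sub => u v /and3P[uA vA uv].
by apply: connect1; rewrite /restr !sAB.
Qed.

Lemma connP A :
  reflect (A != set0 /\ {in A &, forall x y, connect (restr A) x y}) (conn A).
Proof.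
apply: (iffP andP) => -[nA h]; split=> //.
  by move=> x y xA yA; move/forall_inP: h => /(_ x xA) /forall_inP /(_ y yA).
by apply/forall_inP => x xA; apply/forall_inP => y yA; apply: h.
Qed.

Lemma conn_center A x : x \in A ->
  {in A, forall y, connect (restr A) x y} -> conn A.
Proof.
move=> xA h; apply/connP; split; first by apply/set0Pn; exists x.
move=> y z yA zA; apply: (connect_trans (y := x)); last exact: h.
by rewrite connect_restrC h.
Qed.

Lemma conn1 x : conn [set x].
Proof.
by apply: (@conn_center _ x) => [|y]; rewrite inE // => /eqP ->.
Qed.

Lemma connU_common A B x :
  conn A -> conn B -> x \in A -> x \in B -> conn (A :|: B).
Proof.
move=> /connP[_ hA] /connP[_ hB] xA xB.
apply: (@conn_center _ x) => [|y]; rewrite inE ?xA // => /orP[yA|yB].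
  by apply: connect_restrS (hA _ _ xA yA); apply: subsetUl.
by apply: connect_restrS (hB _ _ xB yB); apply: subsetUr.
Qed.

Lemma connU A B : conn A -> conn B -> adjs A B -> conn (A :|: B).
Proof.
move=> /connP[_ hA] /connP[_ hB] /adjsP[a [b [aA bB ab]]].
apply: (@conn_center _ a) => [|y]; rewrite inE ?aA // => /orP[yA|yB].
  by apply: connect_restrS (hA _ _ aA yA); apply: subsetUl.
apply: (connect_trans (y := b)).
  by apply: connect1; rewrite /restr !inE aA bB orbT ab.
by apply: connect_restrS (hB _ _ bB yB); apply: subsetUr.
Qed.

Lemma conn_path x p : path e x p -> conn [set y in x :: p].
Proof.
elim: p x => [|y p IH] x /=; first by move=> _; rewrite set_cons set_nil setU0 conn1.
move=> /andP[xy /IH cp]; rewrite set_cons; apply: connU => //; first exact: conn1.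
by apply: (@adjs_in _ _ x y) => //; rewrite !inE eqxx.
Qed.

Lemma restr_path A x p : path (restr A) x p -> path e x p /\ {subset p <= A}.
Proof.
elim: p x => //= y p IH x /andP[/and3P[_ yA ->]] /IH[-> sp]; split=> // z.
by rewrite inE => /orP[/eqP -> //|/sp].
Qed.

(** [K] is the set of inner vertices of a simple path from [x] to [y]. It is empty when the path is
    a single edge, whence the guard on the last clause; [x |: K] is a usable branch set in both
    cases. *)
Lemma connect_between F x y : x != y -> connect (restr F) x y ->
  exists K, [/\ K \subset F :\: [set x; y], conn (x |: K),
    adjs (x |: K) [set y] & K != set0 ->
      [/\ conn K, adjs K [set x] & adjs K [set y]]].
Proof.
move=> xy /connectP[p0 pp ey]; case: (shortenP pp) ey => p pp' up sp.
case: (lastP p) pp' up sp => [|q y']; first by move=> _ _ _ e0; rewrite e0 eqxx in xy.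
rewrite last_rcons => /restr_path[pp' sF] up _ ey; rewrite -{y'}ey in pp' sF up.
move: up; rewrite /= mem_rcons inE negb_or xy /= rcons_uniq => /and3P[xq yq uq].
rewrite rcons_path in pp'; case/andP: pp' => pq lq.
exists [set z in q]; split.
- apply/subsetP => z; rewrite !inE => zq; rewrite sF ?mem_rcons ?inE ?zq ?orbT // andbT.
  by apply/norP; split; apply: contraTneq zq => ->.
- by rewrite -set_cons; apply: conn_path.
- apply: (@adjs_in _ _ (last x q) y); rewrite ?inE //.
  by have := mem_last x q; rewrite inE.
case: q pq lq xq yq uq {sF} => [|z q] /=; first by rewrite set_nil eqxx.
move=> /andP[xz pq] lq xq yq uq _; split.
- exact: conn_path.
- by apply: (@adjs_in _ _ z x); rewrite ?inE ?eqxx // eC.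
- apply: (@adjs_in _ _ (last z q) y); rewrite ?inE //.
  by have := mem_last z q; rewrite inE.
Qed.

Definition component F x := [set y | connect (restr F) x y].

Lemma mem_component F x : x \in component F x.
Proof. by rewrite inE connect0. Qed.

Lemma component_closed F x u v :
  u \in F -> u \in component F x -> v \in F -> e u v -> v \in component F x.
Proof.
move=> uF + vF uv; rewrite !inE => h; apply: connect_trans h _.
by apply: connect1; rewrite /restr uF vF.
Qed.

Lemma component_sub F x : x \in F -> component F x \subset F.
Proof.
move=> xF; apply/subsetP => y; rewrite inE => /connectP[p /restr_path[_ sp] ->].
by have := mem_last x p; rewrite inE => /orP[/eqP -> //|/sp].
Qed.

Lemma conn_component F x : x \in F -> conn (component F x).
Proof.
move=> xF; apply: (@conn_center _ x); first exact: mem_component.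
move=> y; rewrite inE => /connectP[p pp ->].
elim/last_ind: p pp => [|p z IH]; first by rewrite connect0.
rewrite rcons_path last_rcons => /andP[pp lz].
apply: connect_trans (IH pp) _; apply: connect1.
have hl : last x p \in component F x by rewrite inE; apply/connectP; exists p.
case/and3P: lz => lF zF ez; rewrite /restr hl ez andbT /=.
exact: (component_closed lF hl zF ez).
Qed.

(* A path is extended at its head until it meets itself. *)
Lemma min_degree2_cycle B : B != set0 ->
    (forall v, v \in B -> 1 < #|[set w in B | e v w]|) ->
  exists c, [/\ cycle e c, uniq c, 2 < size c & {subset c <= B}].
Proof.
move=> /set0Pn[x0 x0B] deg.
have grow n : forall x p, #|B| - size p <= n -> path e x p -> uniq (x :: p) ->
    {subset x :: p <= B} ->
  exists c, [/\ cycle e c, uniq c, 2 < size c & {subset c <= B}].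
  elim: n => [|n IH] x p hn pp up sp.
    have : size (x :: p) <= #|B|.
      rewrite cardE; apply: uniq_leq_size => // z /sp; by rewrite mem_enum.
    by rewrite /=; lia.
  have [y yB /andP[xy yh]] : exists2 y, y \in B & e x y && (y != head x p).
    have /card_gt1P[y [y' [+ + yy']]] := deg x (sp _ (mem_head _ _)).
    rewrite !inE => /andP[yB xy] /andP[yB' xy'].
    have [eqy|ny] := eqVneq y (head x p); last by exists y => //; rewrite xy.
    by exists y' => //; rewrite xy' -eqy eq_sym.
  have yx : y != x by apply: contraTneq xy => ->; rewrite eirr.
  have [yinp|ynp] := boolP (y \in p); last first.
    apply: (IH y (x :: p)) => //=.
    - by lia.
    - by rewrite eC xy.
    - by rewrite inE negb_or yx ynp.
    by move=> z; rewrite inE => /orP[/eqP -> //|/sp].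
  case/splitPr: p / yinp pp up sp yh {hn} => p1 p2 + up sp yh.
  rewrite cat_path /= => /and3P[pp1 l1 _].
  exists (x :: rcons p1 y); split.
  - by rewrite /= !rcons_path last_rcons pp1 l1 eC xy.
  - move: up; rewrite -cat_rcons -cat_cons cat_uniq => /andP[] //.
  - by case: p1 yh {pp1 l1 up sp} => [|? ?] /=; rewrite ?eqxx // size_rcons.
  by move=> z zi; apply: sp; rewrite -cat_rcons -cat_cons mem_cat zi.
apply: (grow #|B| x0 [::]) => //; first by lia.
by move=> z; rewrite inE => /eqP ->.
Qed.

Definition nbhd Z := [set v | [exists z in Z, e z v]].
Definition bd Z S := S :&: nbhd Z.

Lemma nbhdP Z v : reflect (exists2 z, z \in Z & e z v) (v \in nbhd Z).
Proof. by rewrite inE; apply: exists_inP. Qed.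

Lemma nbhd1 v w : (w \in nbhd [set v]) = e v w.
Proof.
by apply/nbhdP/idP => [[z /set1P -> //]|vw]; exists v; rewrite ?inE.
Qed.

Lemma nbhdU1 Z v w : (w \in nbhd (v |: Z)) = e v w || (w \in nbhd Z).
Proof.
apply/nbhdP/orP => [[z /setU1P[-> vw|zZ zw]]|[vw|/nbhdP[z zZ zw]]].
- by left.
- by right; apply/nbhdP; exists z.
- by exists v => //; rewrite setU11.
- by exists z => //; rewrite setU1r.
Qed.

Lemma bdS Z S v : v \in bd Z S -> v \in S.
Proof. by case/setIP. Qed.

Lemma adjs_bd Z S v A : v \in bd Z S -> v \in A -> adjs Z A.
Proof. by case/setIP => _ /nbhdP[z zZ zv] vA; apply: (adjs_in zZ vA zv). Qed.

Definition splittable Z S := exists x y p q,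
  [/\ x \in bd Z S /\ y \in bd Z S, e x y,
      p \in S :\: [set x; y], q \in S :\: [set x; y]
    & ~~ connect (restr (S :\: [set x; y])) p q].

(** * Separating boundary edges from excluded minors *)

Section NoMinor.
Hypothesis noK5 : forall s, ~~ K5_model s.
Hypothesis noK33 : forall s t, ~~ K33_model s t.
Variables Z S : {set W}.
Hypotheses (cZ : conn Z) (dZS : [disjoint Z & S]).

Let notZ A : A \subset S -> [disjoint Z & A].
Proof. by move=> sA; rewrite disjoint_sym (disjointWl sA) // disjoint_sym. Qed.

(** If none of the edges [va], [vb], [vc] separates, paths in [S] avoiding it link the other two of
    [a], [b], [c]. If two such paths meet, their union [K] sees all three, and [Z], [v], [K] against
    [a], [b], [c] is a [K33]. If they are disjoint, appending them to [a], [b], [c] gives, with [Z]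
    and [v], a [K5]. *)
Lemma three_bd_nbrs v a b c : v \in bd Z S ->
    a \in bd Z S -> b \in bd Z S -> c \in bd Z S ->
    e v a -> e v b -> e v c -> a != b -> b != c -> a != c ->
  splittable Z S.
Proof.
move=> bv ba bb bc va vb vc ab bc' ac.
have ne x y : e x y -> x != y by apply: contraTneq => ->; rewrite eirr.
have [Sv Sa Sb Sc] : [/\ v \in S, a \in S, b \in S & c \in S].
  by split; apply: bdS; eassumption.
have tri x y w : w \in bd Z S -> x \in bd Z S -> y \in bd Z S ->
    e v x -> e v y -> e v w -> x != w -> y != w ->
    splittable Z S \/ connect (restr (S :\: [set v; w])) x y.
  move=> bw bx by' vx vy vw xw yw; case: (boolP (connect _ x y)); first by right.
  move=> nc; left; exists v, w, x, y; split=> //.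
    by rewrite !inE negb_or xw eq_sym (ne _ _ vx) (bdS bx).
  by rewrite !inE negb_or yw eq_sym (ne _ _ vy) (bdS by').
have [//|cab] := tri a b c bc ba bb va vb vc ac bc'.
have [ba' ca cb] : [/\ b != a, c != a & c != b] by split; rewrite eq_sym.
have [//|cbc] := tri b c a ba bb bc vb vc va ba' ca.
have [//|cca] := tri c a b bb bc ba vc va vb cb ab.
have [Kab [sab Cab Aab nab]] := connect_between ab cab.
have [Kbc [sbc Cbc Abc nbc]] := connect_between bc' cbc.
have [Kca [sca Cca Aca nca]] := connect_between ca cca.
set T := S :\: [set v; a; b; c].
have [tab tbc tca] : [/\ Kab \subset T, Kbc \subset T & Kca \subset T].
  split; [move: sab|move: sbc|move: sca] => /subsetP h; apply/subsetP => z /h;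
  by rewrite !inE; do ![case: eqP => //= _]; rewrite ?orbT ?andbF.
have notT K x : K \subset T -> x \in [set v; a; b; c] -> x \notin K.
  move=> sK xI; apply/negP => /(subsetP sK); by rewrite inE xI.
have TS K : K \subset T -> K \subset S.
  by move=> h; apply: subset_trans h (subsetDl _ _).
have d1 x K : x \in [set v; a; b; c] -> K \subset T -> [disjoint [set x] & K].
  by move=> xI sK; rewrite disjoints1 notT.
have dd x y : x != y -> [disjoint [set x] & [set y]].
  by move=> xy; rewrite disjoints1 inE.
have [iv ia ib ic] : [/\ v \in [set v; a; b; c], a \in [set v; a; b; c],
   b \in [set v; a; b; c] & c \in [set v; a; b; c]].
  by rewrite !inE !eqxx ?orbT.
have s1 x : x \in S -> [set x] \subset S by rewrite sub1set.
have k33 K : K \subset T -> conn K -> adjs K [set a] -> adjs K [set b] ->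
    adjs K [set c] -> False.
  move=> sK cK Ka Kb Kc.
  have := noK33 [:: Z; [set v]; K] [:: [set a]; [set b]; [set c]].
  move=> /negP[]; rewrite /K33_model /allrel; split_andb; rewrite ?conn1 ?adjs1 //.
  all: try by apply: dd; rewrite // ne.
  all: try by apply: notZ; rewrite ?s1 // TS.
  all: try by [apply: d1|rewrite disjoint_sym d1|apply: (adjs_bd (S := S) _ (set11 _))].
have inter x y w K1 K2 : K1 \subset T -> K2 \subset T ->
    (K1 != set0 -> [/\ conn K1, adjs K1 [set x] & adjs K1 [set y]]) ->
    (K2 != set0 -> [/\ conn K2, adjs K2 [set y] & adjs K2 [set w]]) ->
    ~~ [disjoint K1 & K2] ->
    [/\ K1 :|: K2 \subset T, conn (K1 :|: K2), adjs (K1 :|: K2) [set x],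
    adjs (K1 :|: K2) [set y] & adjs (K1 :|: K2) [set w]].
  move=> t1 t2 n1 n2 /pred0Pn[z /= /andP[z1 z2]].
  have [c1 x1 y1] : [/\ conn K1, adjs K1 [set x] & adjs K1 [set y]].
    by apply: n1; apply/set0Pn; exists z.
  have [c2 y2 w2] : [/\ conn K2, adjs K2 [set y] & adjs K2 [set w]].
    by apply: n2; apply/set0Pn; exists z.
  split.
  - by rewrite subUset t1.
  - exact: connU_common c1 c2 z1 z2.
  - by apply: adjsS x1; rewrite ?subsetUl.
  - by apply: adjsS y1; rewrite ?subsetUl.
  - by apply: adjsS w2; rewrite ?subsetUr.
have dabc : [disjoint Kab & Kbc].
  apply/negPn/negP => /(inter a b c Kab Kbc tab tbc nab nbc)[t k A1 A2 A3].
  exact: (k33 _ t k A1 A2 A3).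
have dbca : [disjoint Kbc & Kca].
  apply/negPn/negP => /(inter b c a Kbc Kca tbc tca nbc nca)[t k A1 A2 A3].
  exact: (k33 _ t k A3 A1 A2).
have dcab : [disjoint Kca & Kab].
  apply/negPn/negP => /(inter c a b Kca Kab tca tab nca nab)[t k A1 A2 A3].
  exact: (k33 _ t k A2 A3 A1).
have dU x y K1 K2 : x != y -> x \in [set v; a; b; c] -> y \in [set v; a; b; c] ->
    K1 \subset T -> K2 \subset T -> [disjoint K1 & K2] ->
    [disjoint x |: K1 & y |: K2].
  move=> xy xI yI t1 t2 d12.
  rewrite disjoint_subset; apply/subsetP => z /setU1P[->|z1].
    by rewrite inE in_setU1 negb_or xy notT.
  rewrite inE in_setU1 negb_or (disjointFr d12 z1) andbT.
  by apply: contraTneq z1 => ->; rewrite notT.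
have sU x K : x \in S -> K \subset T -> x |: K \subset S.
  by move=> xS sK; rewrite subUset sub1set xS TS.
have dv x K : x \in [set a; b; c] -> e v x -> K \subset T -> [disjoint [set v] & x |: K].
  by move=> xI vx sK; rewrite disjoints1 in_setU1 negb_or ne // notT.
have := noK5 [:: Z; [set v]; a |: Kab; b |: Kbc; c |: Kca].
move=> /negP[]; rewrite /K5_model; split_andb; rewrite ?conn1 //.
all: try by apply: notZ; rewrite ?s1 // sU.
all: try by apply: dv; rewrite // !inE eqxx ?orbT.
all: try by apply: dU; rewrite // disjoint_sym.
all: try by [apply: (adjs_bd (S := S) _ (set11 _))|apply: (adjs_bd (S := S) _ (setU11 _ _))].
all: try by [apply: (adjs_in (set11 _) (setU11 _ _))].
- by apply: adjsS Aab; rewrite ?sub1set ?setU11.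
- by rewrite adjsC; apply: adjsS Aca; rewrite ?sub1set ?setU11.
- by apply: adjsS Abc; rewrite ?sub1set ?setU11.
Qed.

(* The vertices of the cycle [c] all see [Z]; a component [D] of the rest which
   also sees [Z] attaches to the cycle along an edge at most. *)
Lemma cycle_in_bd v1 c : cycle e c -> uniq c -> 2 < size c ->
    {subset c <= bd Z S} -> v1 \in bd Z S -> v1 \notin c ->
  splittable Z S.
Proof.
move=> cc uc sc cB v1B v1c.
set C := [set x in c].
have v1F : v1 \in S :\: C by rewrite !inE v1c (bdS v1B).
pose D := component (S :\: C) v1.
have cD : conn D := conn_component v1F.
have sD : D \subset S :\: C := component_sub v1F.
have DS : D \subset S := subset_trans sD (subsetDl _ _).
have ZD : adjs Z D := adjs_bd v1B (mem_component _ _).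
have cS x : x \in c -> x \in S by move/cB/bdS.
have dD A : {subset A <= C} -> [disjoint A & D].
  move=> sA; rewrite disjoint_sym (disjointWl sD) //.
  rewrite -setI_eq0; apply/eqP/setP => z; rewrite !inE.
  by case: (boolP (z \in A)) => [/sA|]; rewrite ?andbF // inE => ->.
have Z1 x : x \in c -> [disjoint Z & [set x]].
  by move=> xc; rewrite notZ // sub1set cS.
pose A := C :&: nbhd D.
have AP x : x \in A -> x \in c /\ adjs [set x] D.
  move=> /setIP[]; rewrite inE => xc /nbhdP[z zD zx]; split=> //.
  by apply: (adjs_in (set11 _) zD); rewrite eC.
(* Two nonadjacent attachments [a], [b] of [D] cut the cycle into nonempty arcs [P] and [Q]; then
   [Z], [a], [b] against [P], [Q], [D] is a [K33]. *)
have [/existsP[a /existsP[b /and4P[aA bA ab nab]]]|] :=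
  boolP [exists a, exists b, [&& a \in A, b \in A, a != b & ~~ e a b]].
  exfalso; have [ac aD] := AP _ aA; have [bc bD] := AP _ bA.
  have [i s rs] := rot_to ac.
  have memc x : (x \in c) = (x \in a :: s) by rewrite -rs mem_rot.
  have us : uniq (a :: s) by rewrite -rs rot_uniq.
  have cs : cycle e (a :: s) by rewrite -rs rot_cycle.
  have bs : b \in s by move: bc; rewrite memc inE eq_sym (negbTE ab).
  case/splitPr: s / bs us cs memc {rs} => p q us + memc.
  rewrite /= rcons_cat cat_path /= => /and3P[pp lb pq].
  case: p => [|p0 p] in us memc pp lb *; first by rewrite lb in nab.
  case/lastP: q us memc pq => [|q' q0] us memc pq.
    by move: pq nab; rewrite /= andbT eC => ->.
  move: pp pq => /= /andP[ap pp]; rewrite rcons_path last_rcons => /andP[pq qa].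
  set P := [set x in p0 :: p]; set Q := [set x in rcons q' q0].
  have sP : {subset P <= C}.
    by move=> x; rewrite !inE memc inE mem_cat => xp; rewrite in_cons xp orbT.
  have sQ : {subset Q <= C}.
    by move=> x; rewrite !inE memc inE mem_cat !in_cons => ->; rewrite !orbT.
  have [q1 [q'' eq]] : exists q1 q'', rcons q' q0 = q1 :: q''.
    by case: (q') => [|q1 q'']; [exists q0, [::]|exists q1, (rcons q'' q0)].
  have cQ : conn Q.
    by rewrite /Q eq; apply: conn_path; move: pq; rewrite eq /= => /andP[].
  have bq : e b q1 by move: pq; rewrite eq /= => /andP[].
  have cP : conn P := conn_path pp.
  have ZA (X : {set W}) x : {subset X <= C} -> x \in X -> adjs Z X.
    by move=> sX xX; apply: (adjs_bd _ xX); apply: cB; have := sX _ xX; rewrite inE.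
  have ZN (X : {set W}) : {subset X <= C} -> [disjoint Z & X].
    move=> sX; apply: notZ; apply/subsetP => x /sX; rewrite inE; exact: cS.
  have := noK33 [:: Z; [set a]; [set b]] [:: P; Q; D].
  have [ap' aq bp bq' pq'] := uniq_two_arcs us.
  have s1 x : x \in c -> {subset [set x] <= C} by move=> xc y /set1P ->; rewrite inE.
  move=> /negP[]; rewrite /K33_model /allrel; split_andb; rewrite ?conn1 //.
  all: try by [apply: Z1|apply: ZN|apply: notZ|apply: dD|apply: dD; apply: s1].
  all: try by rewrite disjoints1 inE.
  - rewrite -setI_eq0; apply/eqP/setP => z; rewrite !inE; apply/negP => /andP[].
    by move/pq'/negP.
  - by apply: (ZA _ p0); rewrite // inE mem_head.
  - by apply: (ZA _ q0); rewrite // inE mem_rcons mem_head.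
  - by apply: (@adjs_in _ _ a p0); rewrite ?inE ?eqxx.
  - by apply: (@adjs_in _ _ a q0); rewrite ?inE ?mem_rcons ?mem_head // eC.
  - by apply: (@adjs_in _ _ b (last p0 p)); rewrite ?set11 // 1?eC // inE mem_last.
  - by apply: (@adjs_in _ _ b q1); rewrite ?inE ?eq ?mem_head.
rewrite negb_exists => /forallP adjA.
have adjA' a b : a \in A -> b \in A -> a != b -> e a b.
  move=> aA bA ab; move: (adjA a); rewrite negb_exists => /forallP /(_ b).
  by rewrite aA bA ab negbK.
have d1 x y : x != y -> [disjoint [set x] & [set y]].
  by move=> xy; rewrite disjoints1 inE.
(* Three attachments are pairwise adjacent by now and form a [K5] with [Z] and [D]. *)
have [/card_gt2P[x [y [z [[xA yA zA] [xy yz zx]]]]]|A2] := ltnP 2 #|A|.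
  have [[xc xD] [yc yD] [zc zD]] := And3 (AP _ xA) (AP _ yA) (AP _ zA).
  have := noK5 [:: [set x]; [set y]; [set z]; Z; D].
  move=> /negP[]; rewrite /K5_model; split_andb; rewrite ?conn1 ?adjs1 //.
  all: try by [apply: notZ|apply: d1|apply: d1; rewrite eq_sym].
  all: try by [apply: adjA'|apply: adjA'; rewrite // eq_sym].
  all: try by [rewrite disjoint_sym; apply: Z1].
  all: try by [apply: dD => ? /set1P ->; rewrite inE].
  1-3: by rewrite adjsC; apply: (adjs_bd (S := S) _ (set11 _)); exact: cB.
(* Two attachments are joined by an edge, possibly a chord; a single one, or none, is completed to
   an edge of the cycle. *)
have [x [y [xc yc xy AXY]]] : exists x y, [/\ x \in c, y \in c, e x y & A \subset [set x; y]].
  have nxt x : x \in c -> next c x \in c /\ e x (next c x).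
    by move=> xc; rewrite mem_next xc (next_cycle cc).
  move: A2; rewrite leq_eqVlt => /orP[/cards2P[x [y [xy eA]]]|].
    have xA : x \in A by rewrite eA !inE eqxx.
    have yA : y \in A by rewrite eA !inE eqxx orbT.
    by exists x, y; rewrite (AP _ xA).1 (AP _ yA).1 eA adjA'.
  rewrite ltnS leq_eqVlt => /orP[/cards1P[x eA]|].
    have /AP[xc _] : x \in A by rewrite eA inE.
    have [nc en] := nxt _ xc; exists x, (next c x); split=> //.
    by rewrite eA sub1set !inE eqxx.
  rewrite ltnS leqn0 cards_eq0 => /eqP ->.
  case: (c) sc cc nxt => // x c' _ _ nxt.
  have [nc en] := nxt _ (mem_head _ _); exists x, (next (x :: c') x).
  by rewrite sub0set mem_head.
have [p pc /andP[px py]] : exists2 p, p \in c & (p != x) && (p != y).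
  have : ~~ (c \subset [:: x; y]).
    apply/negP => /subsetP h; have := uniq_leq_size uc h; by rewrite /= leqNgt sc.
  by case/subsetPn => p pc; rewrite !inE negb_or => h; exists p.
have v1x z : z \in c -> v1 != z by apply: contraTneq => <-.
exists x, y, v1, p; split=> //.
- by split; apply: cB.
- by rewrite !inE negb_or !v1x // (bdS v1B).
- by rewrite !inE negb_or px py cS.
apply/negP => /connectP[s ps ep].
(* A path from [v1] can leave [D] only through an attachment, hence through [x] or [y]. *)
suff : p \in D by move/(subsetP sD); rewrite !inE pc.
rewrite ep; elim/last_ind: s ps {ep} => [|s z IH]; first by rewrite mem_component.
rewrite rcons_path last_rcons => /andP[/IH lD /and3P[_ zF lz]].
have zS : z \in S by move: zF; rewrite inE => /andP[].
apply: (component_closed (subsetP sD _ lD) lD _ lz); rewrite !inE zS andbT.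
apply/negP => zc; have : z \in A by rewrite !inE zc /=; apply/exists_inP; exists (last v1 s).
by move/(subsetP AXY); apply/negP; move: zF; rewrite inE => /andP[].
Qed.

End NoMinor.
End Minors.

(** * Nice index functions *)

Section NiceIndexFunctions.
Variables (W : finType) (e : rel W).
Hypotheses (eC : symmetric e) (eirr : irreflexive e).
Implicit Types (A B D F K S U Z : {set W}) (x y z u v w : W).
Implicit Types (eta : W -> nat) (L : seq (W * W)) (r : rel W).

Notation bd := (bd e).
Notation induced S := (restr e S).

(** [r] is a parameter because an edge may be deleted from the graph induced on [S]. Vanishing
    outside [S] lets the functions of two parts be added. *)
Definition nice Z S r eta L :=
  [/\ edge_list r L, coef L eta <> 0%R,
      forall v, v \in bd Z S -> eta v <= 2,
      forall v, eta v <= 4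
    & forall v, v \notin S -> eta v = 0].

(** The digit counts the vertices forced to exponent 0. The goal is [nice2]; the weaker forms serve
    when the induction passes to a pair with only one marked vertex, or none. *)
Definition nice0 Z S := exists eta L, nice Z S (induced S) eta L.
Definition nice1 Z S v := exists eta L, nice Z S (induced S) eta L /\ eta v = 0.
Definition nice2 Z S v1 v2 := exists eta L,
  [/\ nice Z S (del_edge (induced S) v1 v2) eta L, eta v1 = 0 & eta v2 = 0].

Lemma incrs_enum eta U x : incrs eta (enum U) x = eta x + (x \in U).
Proof. by rewrite /incrs count_uniq_mem ?enum_uniq // mem_enum. Qed.

Lemma edge_list_avoids r L v :
  edge_list r L -> (forall x, ~~ r v x) -> avoids L v.
Proof.
move=> [_ _ eL] h; apply/allP => -[x y] xyL /=.
apply/andP; split; apply/eqP => ?; subst.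
  by have := h y; rewrite eL xyL.
by have := h x; rewrite eL xyL orbT.
Qed.

Lemma edge_list_addv r r' L' v (U : seq W) : edge_list r' L' ->
    (forall x, ~~ r' v x) -> uniq U -> v \notin U ->
    (forall x y, r x y =
      [|| r' x y, (x == v) && (y \in U) | (y == v) && (x \in U)]) ->
  edge_list r (star v U ++ L').
Proof.
move=> hL nv uU vU hr.
pose rs x y := ((x == v) && (y \in U)) || ((y == v) && (x \in U)).
apply: (edge_list_cat (r1 := rs) (r2 := r')) => //.
- exact: edge_list_star.
- move=> x y /orP[] /andP[/eqP -> _]; rewrite ?nv //.
  by rewrite (edge_list_sym _ _ hL) nv.
- by move=> x y; rewrite hr orbC.
Qed.

Lemma induced_irr S v : v \notin S -> forall x, ~~ induced S v x.
Proof. by move=> vS x; rewrite /restr (negbTE vS). Qed.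

Lemma induced_rem S v x y : v \in S ->
  induced S x y = [|| induced (S :\ v) x y,
    (x == v) && (y \in S :&: [set w | e v w])
    | (y == v) && (x \in S :&: [set w | e v w])].
Proof.
move=> vS; rewrite /restr !inE.
case: (eqVneq x v) => [->|xv]; case: (eqVneq y v) => [->|yv] //=;
  rewrite ?eirr ?andbF ?orbF ?vS //=.
by rewrite [e x v]eC.
Qed.

(* All edges at [v] are given to the other end, so that [v] gets exponent 0. *)
Lemma nice0_push Z Z' S v : v \in S ->
    nice0 Z' (S :\ v) -> (forall w, w \in S -> e v w -> w \in nbhd e Z') ->
    (forall w, w \in bd Z S -> w != v -> ~~ e v w /\ w \in nbhd e Z') ->
  nice1 Z S v.
Proof.
move=> vS [eta [L' [eL nz b2 b4 b0]]] sub hB.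
set U := S :&: [set w | e v w].
have ev : eta v = 0 by apply: b0; rewrite !inE eqxx.
have vU : v \notin U by rewrite !inE eirr andbF.
exists (incrs eta (enum U)), (star v (enum U) ++ L'); split; last first.
  by rewrite incrs_enum ev (negbTE vU).
have uE x : x \in U -> x \in S /\ e v x by rewrite !inE => /andP[].
have ub x : x \in U -> eta x <= 2.
  move=> /[dup] xU /uE[xS vx]; apply: b2; rewrite !inE xS.
  have -> : x != v by apply: contraTneq vx => ->; rewrite eirr.
  by have := sub _ xS vx; rewrite inE.
split.
- apply: (edge_list_addv eL).
  + by apply: induced_irr; rewrite !inE eqxx.
  + exact: enum_uniq.
  + by rewrite mem_enum.
  + by move=> x y; rewrite !mem_enum; apply: induced_rem.
- by rewrite coef_push // mem_enum.
- move=> w wB; rewrite incrs_enum.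
  have [->|wv] := eqVneq w v; first by rewrite ev (negbTE vU).
  have [nw wZ] := hB _ wB wv.
  have -> : w \in U = false by rewrite !inE (negbTE nw) andbF.
  by rewrite addn0; apply: b2; rewrite !inE wv (bdS wB) /=; move: wZ; rewrite inE.
- move=> w; rewrite incrs_enum; case: (boolP (w \in U)) => [/ub|_]; first by lia.
  by rewrite addn0.
- move=> w wS; rewrite incrs_enum b0 ?inE ?(negbTE wS) ?andbF //.
Qed.

Lemma del_edge_inS S v1 v2 x y :
  del_edge (induced S) v1 v2 x y -> (x \in S) && (y \in S).
Proof. by case/andP => /and3P[-> ->]. Qed.

(** With no boundary vertex besides [v1] and [v2], the vertex [v1] replaces [Z] altogether. Its
    neighbours other than [v2] are interior for the old [Z], so they can take one unit on top of at
    most 2; [v2] is spared because the edge [v1v2] is deleted. *)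
Lemma nice2_base Z S v1 v2 : v1 \in S -> e v1 v2 ->
    (forall w, w \in bd Z S -> (w == v1) || (w == v2)) ->
    nice1 [set v1] (S :\ v1) v2 ->
  nice2 Z S v1 v2.
Proof.
move=> v1S e12 hB [eta [L' [[eL nz b2 b4 b0] ev2]]].
have v12 : v1 != v2 by apply: contraTneq e12 => ->; rewrite eirr.
set U := S :&: [set w | e v1 w] :\ v2.
have ev : eta v1 = 0 by apply: b0; rewrite !inE eqxx.
have vU : v1 \notin U by rewrite !inE eirr !andbF.
have v2U : v2 \notin U by rewrite !inE eqxx.
exists (incrs eta (enum U)), (star v1 (enum U) ++ L').
split; rewrite ?incrs_enum ?ev ?ev2 ?(negbTE vU) ?(negbTE v2U) //.
have ub x : x \in U -> eta x <= 2.
  rewrite !inE => /andP[_ /andP[xS vx]]; apply: b2; rewrite !inE xS.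
  have -> : x != v1 by apply: contraTneq vx => ->; rewrite eirr.
  by apply/exists_inP; exists v1; rewrite ?inE.
split.
- apply: (edge_list_addv eL).
  + by apply: induced_irr; rewrite !inE eqxx.
  + exact: enum_uniq.
  + by rewrite mem_enum.
  + move=> x y; rewrite !mem_enum /del_edge (induced_rem _ _ v1S) !inE.
    rewrite /restr !inE.
    case: (eqVneq x v1) => [->|xv1]; case: (eqVneq y v1) => [->|yv1] //=;
      rewrite ?eirr ?andbF ?orbF ?(negbTE v12) ?(andbF, andbT) //=.
    * by rewrite andbC.
    * by rewrite andbC.
- by rewrite coef_push // mem_enum.
- by move=> w /hB /orP[] /eqP ->; rewrite incrs_enum ?ev ?ev2 ?(negbTE vU) ?(negbTE v2U).
- move=> w; rewrite incrs_enum; case: (boolP (w \in U)) => [/ub|_]; first by lia.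
  by rewrite addn0.
- by move=> w wS; rewrite incrs_enum b0 ?inE ?(negbTE wS) ?andbF.
Qed.

Lemma nice1_of_nice2 Z S v w :
  v \in S -> w \in S -> e v w -> nice2 Z S v w -> nice1 Z S v.
Proof.
move=> vS wS vw [eta [L [[eL nz b2 b4 b0] ev ew]]].
have nvw : v != w by apply: contraTneq vw => ->; rewrite eirr.
exists (incr eta w), ((v, w) :: L); split; last by rewrite /incr ev (negbTE nvw).
split.
- apply: (edge_list_cons eL) => //.
    by rewrite /del_edge !eqxx /= andbF.
  move=> x y; rewrite /del_edge -orbA.
  case: (boolP ((x == v) && (y == w) || (x == w) && (y == v))) => [hD|_].
    rewrite orbT; case/orP: hD => /andP[/eqP -> /eqP ->];
    by rewrite /restr vS wS // eC.
  by rewrite andbT orbF.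
- by rewrite coef_fix.
- move=> x /b2; rewrite /incr; case: eqP => [->|_]; rewrite ?ew ?addn0 //.
- move=> x; rewrite /incr; case: eqP => [->|_]; rewrite ?ew ?addn0 //.
- by move=> x xS; rewrite /incr b0 //; case: eqP xS => // ->; rewrite wS.
Qed.

(** Marking [x] and [y] in [S2] deletes the edge [xy] there, which is left to [S1], and makes the
    second function vanish on the common vertices, so that the coefficients multiply. *)
Lemma nice2_split Z S v1 v2 x y S1 S2 : e x y -> S1 :|: S2 = S ->
    S1 :&: S2 = [set x; y] ->
    (forall u v, u \in S1 -> v \in S2 -> e u v -> (u \in S2) || (v \in S1)) ->
    v1 \in S1 -> v2 \in S1 ->
    nice2 Z S1 v1 v2 -> nice2 Z S2 x y ->
  nice2 Z S v1 v2.
Proof.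
move=> xy SU SI noe v1S v2S [eta1 [L1 [[eL1 nz1 b21 b41 b01] ev1 ev2]]].
move=> [eta2 [L2 [[eL2 nz2 b22 b42 b02] ex ey]]].
have mS z : (z \in S) = (z \in S1) || (z \in S2) by rewrite -SU inE.
have mI z : (z \in S1) && (z \in S2) = (z == x) || (z == y).
  by have := congr1 (fun A : {set W} => z \in A) SI; rewrite !inE.
have [/andP[x1 x2] /andP[y1 y2]] : ((x \in S1) && (x \in S2)) /\ ((y \in S1) && (y \in S2)).
  by rewrite !mI !eqxx orbT.
have e2S1 z : z \in S1 -> eta2 z = 0.
  move=> z1; case: (boolP (z \in S2)) => [z2|/b02 //].
  by have := mI z; rewrite z1 z2 => /esym /orP[] /eqP ->.
have e1 z : z \notin S1 -> eta1 z = 0 by apply: b01.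
have pt z : (eta1 z + eta2 z = eta1 z /\ z \in S1) \/
            (eta1 z + eta2 z = eta2 z /\ z \notin S1).
  by case: (boolP (z \in S1)) => z1; [left; rewrite e2S1 ?addn0|right; rewrite e1].
have rI u v : del_edge (induced S) v1 v2 u v =
    del_edge (induced S1) v1 v2 u v || del_edge (induced S2) x y u v.
  have rS : induced S u v = induced S1 u v || induced S2 u v.
    rewrite /restr !mS; case: (boolP (e u v)) => uv; last by rewrite !andbF.
    rewrite !andbT; have := noe u v; have := noe v u; rewrite [e v u]eC uv.
    by do ![case: (_ \in _) => //=] => h1 h2; (have := h1 isT isT isT) || (have := h2 isT isT isT).
  rewrite /del_edge rS.
  case: (boolP ((u == x) && (v == y) || (u == y) && (v == x))) => D2.
    have [-> ->] : induced S1 u v /\ induced S2 u v.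
      by case/orP: D2 => /andP[/eqP -> /eqP ->]; rewrite /restr x1 x2 y1 y2 // [e y x]eC.
    by rewrite andbF orbF.
  rewrite andbT.
  case: (boolP ((u == v1) && (v == v2) || (u == v2) && (v == v1))) => [D1|_];
    rewrite ?andbT //= !andbF.
  apply/esym/negbTE/negP => /and3P[u2 v2' uv]; case/negP: D2.
  have : (u \in S1) && (v \in S1).
    by case/orP: D1 => /andP[/eqP -> /eqP ->]; rewrite v1S v2S.
  move=> /andP[u1 v1']; have := mI u; have := mI v.
  rewrite u1 u2 v1' v2' /= => /esym hv /esym hu.
  by case/orP: hu uv => /eqP ->; case/orP: hv => /eqP ->; rewrite ?eirr ?eqxx ?orbT.
exists (fun z => eta1 z + eta2 z), (L1 ++ L2); split; last 2 first.
- by rewrite ev1 e2S1.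
- by rewrite ev2 e2S1.
split.
- apply: (edge_list_cat eL1 eL2) => // u v.
  move=> /[dup] /del_edge_inS /andP[u1 v1'] _; apply/negP => /[dup] /del_edge_inS.
  move=> /andP[u2 v2'] /andP[/and3P[_ _ uv]].
  have := mI u; have := mI v; rewrite u1 u2 v1' v2' /= => /esym hv /esym hu.
  by case/orP: hu uv => /eqP ->; case/orP: hv => /eqP ->; rewrite ?eirr ?eqxx ?orbT.
- rewrite coef_cat //; first by apply/eqP; rewrite mulf_neq0 //; apply/eqP.
  move=> [u v] uvL /=; have : del_edge (induced S1) v1 v2 u v.
    by case: eL1 => _ _ ->; rewrite uvL.
  by move=> /del_edge_inS /andP[u1 v1']; rewrite !e2S1.
- move=> z /setIP[zS zZ]; have [[-> z1]|[-> z1]] := pt z.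
    by apply: b21; rewrite inE z1.
  by apply: b22; rewrite inE zZ andbT; move: zS; rewrite mS (negbTE z1).
- by move=> z; have [[-> _]|[-> _]] := pt z.
- by move=> z; rewrite mS negb_or => /andP[z1 z2]; rewrite e1 // b02.
Qed.

(** With exponent 0 on [F], every factor of the star contributes its centre, so only the sign can
    change. *)
Lemma coef_star_fix v F L eta : v \notin F -> (forall f, f \in F -> eta f = 0) ->
    coef L eta <> 0%R ->
  coef (star v (enum F) ++ L) (fun x => eta x + (x == v) * #|F|) <> 0%R.
Proof.
rewrite cardE -(mem_enum F).
have fE f : f \in F -> f \in enum F by rewrite mem_enum.
move=> vF eF nz; have {eF fE} : forall f, f \in enum F -> eta f = 0.
  by move=> f; rewrite mem_enum; apply: eF.
elim: (enum F) vF => [|f s IH] /=.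
  by move=> _ _; rewrite (_ : (fun _ => _) = eta) //; apply: funext => x; rewrite muln0 addn0.
rewrite inE negb_or => /andP[vf vs] h.
rewrite [f == v]eq_sym (negbTE vf) h ?mem_head // eqxx mul1n addnS /= sub0r.
rewrite (_ : decr _ v = (fun x => eta x + (x == v) * size s)).
  apply/eqP; rewrite oppr_eq0; apply/eqP; apply: IH => // g gs.
  by apply: h; rewrite inE gs orbT.
by apply: funext => x; rewrite /decr; case: eqP => [->|_]; lia.
Qed.

(** Edges from [v] to [v1] and [v2] are given to [v], all others preferably to their other end. This
    fails only if the boundary neighbour [w] in [X] already has exponent 2. Then exponent 1 at [v]
    is tried, sparing [w]. If that coefficient vanishes, a unit can be moved from [w] to another
    neighbour [u] in the function for [S :\ v]; pushing all edges then leaves at most 2 at [w] and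
    at most 2 + 1 + 1 at the interior vertex [u]. This is where the bound 4 is needed in full. *)
Lemma nice2_remove Z S v v1 v2 : v \in bd Z S -> v != v1 -> v != v2 ->
    v1 \in bd Z S -> v2 \in bd Z S ->
    #|[set w in bd Z S | e v w]| <= 2 ->
    #|[set w in bd Z S | [&& e v w, w != v1 & w != v2]]| <= 1 ->
    nice2 (v |: Z) (S :\ v) v1 v2 ->
  nice2 Z S v1 v2.
Proof.
move=> bv vv1 vv2 bv1 bv2 deg2; set X := [set w in bd Z S | _] => X1.
move=> [eta [L' [[eL nz b2 b4 b0] ev1 ev2]]].
have vS := bdS bv.
pose F := S :&: [set w | e v w] :&: [set v1; v2].
pose U := (S :&: [set w | e v w]) :\: [set v1; v2].
have ev : eta v = 0 by apply: b0; rewrite !inE eqxx.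
have vU : v \notin U by rewrite !inE eirr !andbF.
have vF : v \notin F by rewrite !inE eirr !andbF.
have [v1U v2U] : v1 \notin U /\ v2 \notin U by rewrite !inE !eqxx ?orbT.
have b2' w : w \in bd Z S -> w != v -> eta w <= 2.
  by move=> wB wv; apply: b2; rewrite inE in_setD1 wv (bdS wB) nbhdU1 (setIP wB).2 orbT.
have UE w : w \in U -> [/\ w != v, w \in S & e v w].
  rewrite !inE => /andP[_ /andP[wS vw]]; split=> //.
  by apply: contraTneq vw => ->; rewrite eirr.
have bU w : w \in U -> eta w <= 2.
  by move=> /UE[wv wS vw]; apply: b2; rewrite inE in_setD1 wv wS nbhdU1 vw.
have UX w : w \in U -> w \in bd Z S -> w \in X.
  move=> + wB; rewrite /X inE wB /= => /[dup] /UE[_ _ ->].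
  by rewrite !inE negb_or => /andP[/andP[-> ->]].
have avL' : avoids L' v.
  apply: edge_list_avoids eL _ => x; rewrite /del_edge negb_and.
  by rewrite induced_irr // !inE eqxx.
(* The edges to [v1] and [v2] are charged to [v] once and for all here; [etaU] accounts for the
   remaining edges. *)
have fin Us etaU : uniq Us -> Us =i U -> coef (star v Us ++ L') etaU <> 0%R ->
    etaU v1 = 0 -> etaU v2 = 0 -> etaU v + #|F| <= 2 ->
    (forall w, w \in bd Z S -> w != v -> etaU w <= 2) ->
    (forall w, w != v -> etaU w <= 4) -> (forall w, w \notin S -> etaU w = 0) ->
    nice2 Z S v1 v2.
  move=> uU mU nzU e1 e2 hv h2 h4 h0.
  exists (fun x => etaU x + (x == v) * #|F|), (star v (enum F ++ Us) ++ L').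
  split; last 2 first.
  - by rewrite e1 eq_sym (negbTE vv1).
  - by rewrite e2 eq_sym (negbTE vv2).
  have FE f : f \in F -> etaU f = 0.
    by rewrite !inE => /andP[_ /orP[]] /eqP ->.
  split.
  - apply: (edge_list_addv eL).
    + by move=> x; rewrite /del_edge negb_and induced_irr // !inE eqxx.
    + rewrite cat_uniq enum_uniq uU andbT; apply/hasPn => z.
      by rewrite mU /= mem_enum !inE => /andP[/negbTE ->]; rewrite andbF.
    + by rewrite mem_cat mem_enum mU negb_or vF.
    + move=> x y; rewrite !mem_cat !mem_enum !mU.
      have FU z : (z \in F) || (z \in U) = (z \in S :&: [set w | e v w]).
        by rewrite !inE; do ![case: (_ == _)]; rewrite ?andbF ?andbT ?orbF.
      rewrite !FU /del_edge (induced_rem x y vS).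
      case: (boolP ((x == v1) && (y == v2) || (x == v2) && (y == v1))) => D.
        by case/orP: D => /andP[/eqP -> /eqP ->];
          rewrite !andbF ![v1 == v]eq_sym ![v2 == v]eq_sym (negbTE vv1) (negbTE vv2).
      by rewrite !andbT.
  - by rewrite /star map_cat -catA; apply: coef_star_fix.
  - move=> w wB; case: (eqVneq w v) => [->|wv]; first by rewrite mul1n.
    by rewrite mul0n addn0 h2.
  - move=> w; case: (eqVneq w v) => [->|wv]; first by rewrite mul1n (leq_trans hv).
    by rewrite mul0n addn0 h4.
  - move=> w wS; rewrite h0 //; case: eqP wS => // ->; by rewrite vS.
have F2 : #|F| <= 2.
  apply: leq_trans (_ : #|[set v1; v2]| <= 2); last by rewrite cards2; case: (_ == _).
  by apply: subset_leq_card; apply: subsetIr.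
(* [w] and the members of [F] are distinct boundary neighbours of [v], of which there are at most
   two; this leaves room for one more unit at [v]. *)
have F1 w : w \in X -> #|F| <= 1.
  rewrite /X !inE -!andbA => /and5P[wS wZ vw wv1 wv2].
  have wF : w \notin F by rewrite !inE (negbTE wv1) (negbTE wv2) andbF.
  have : #|w |: F| <= 2.
    apply: leq_trans deg2; apply: subset_leq_card; apply/subsetP => z.
    case/setU1P => [->|]; first by rewrite !inE wS wZ.
    by rewrite !inE -andbA => /and3P[zS vz /orP[]/eqP ez]; rewrite vz andbT;
      move: bv1 bv2; rewrite ez !inE.
  by rewrite cardsU1 wF.
have incr_bounds etaU : (forall w, w \in U -> etaU w <= 3) -> etaU v = 0 ->
    (forall w, w \notin U -> etaU w = eta w) ->
    (forall w, w \in X -> etaU w <= 1) ->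
    coef L' etaU <> 0%R -> nice2 Z S v1 v2.
  move=> h3 hv hn hX nzU.
  apply: (fin (enum U) (incrs etaU (enum U))).
  - exact: enum_uniq.
  - by move=> z; rewrite mem_enum.
  - by rewrite coef_push // mem_enum.
  - by rewrite incrs_enum (negbTE v1U) hn // ev1.
  - by rewrite incrs_enum (negbTE v2U) hn // ev2.
  - by rewrite incrs_enum (negbTE vU) hv.
  - move=> w wB wv; rewrite incrs_enum; case: (boolP (w \in U)) => wU.
      by have := hX _ (UX _ wU wB); clear; lia.
    by rewrite hn // addn0 b2'.
  - move=> w wv; rewrite incrs_enum; case: (boolP (w \in U)) => wU.
      by have := h3 _ wU; clear; lia.
    by rewrite hn // addn0.
  - move=> w wS; have wU : w \notin U by rewrite !inE (negbTE wS) andbF.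
    by rewrite incrs_enum (negbTE wU) hn // b0 // !inE (negbTE wS) andbF.
have [/existsP[w /andP[wX ew]]|noX] := boolP [exists w, (w \in X) && (1 < eta w)]; last first.
  apply: (incr_bounds eta) => // w; first by move/bU; clear; lia.
  move=> wX; move: noX; rewrite negb_exists => /forallP /(_ w).
  by rewrite wX -leqNgt.
have wB : w \in bd Z S by move: wX; rewrite !inE => /andP[].
have wU : w \in U by move: wX wB; rewrite !inE negb_or => /andP[_ /and3P[-> -> ->]] /andP[->].
have [wv wS vw] := UE _ wU.
have XE z : z \in X -> z = w.
  by move=> zX; have /card_le1_eqP := X1; apply.
pose U0 := U :\ w.
have vU0 : v \notin enum U0 by rewrite mem_enum !inE eirr !andbF.
have wU0 : w \notin U0 by rewrite !inE eqxx.
have vw' : v != w by rewrite eq_sym.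
case: (eqVneq (coef (star v (w :: enum U0) ++ L')
                    (incr (incrs eta (enum U0)) v)) 0%R) => [D0|/eqP D0];
  last first.
  apply: (fin (w :: enum U0) (incr (incrs eta (enum U0)) v)) => //.
  - by rewrite /= enum_uniq mem_enum wU0.
  - move=> z; rewrite inE mem_enum in_setD1; case: eqP => [->|//]; by rewrite wU.
  - by rewrite /incr incrs_enum eq_sym (negbTE vv1) ev1 in_setD1 (negbTE v1U) andbF.
  - by rewrite /incr incrs_enum eq_sym (negbTE vv2) ev2 in_setD1 (negbTE v2U) andbF.
  - rewrite /incr incrs_enum eqxx ev -mem_enum (negbTE vU0) /=.
    by have := F1 _ wX; clear; lia.
  - move=> z zB zv; rewrite /incr incrs_enum (negbTE zv) in_setD1.
    case: (boolP (z \in U)) => zU; last by rewrite andbF !addn0 b2'.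
    by rewrite (XE z (UX _ zU zB)) eqxx !addn0 b2'.
  - move=> z zv; rewrite /incr incrs_enum (negbTE zv) in_setD1 addn0.
    case: (boolP (z \in U)) => [/bU|_]; first by case: (z == w) => /=; clear; lia.
    by rewrite andbF addn0.
  - move=> z zS; have zv : z == v = false by apply: contraNF zS => /eqP ->.
    by rewrite /incr incrs_enum zv b0 !inE (negbTE zS) !andbF.
have w0 : (0 < incr (incrs eta (enum U0)) v w) by move: ew; rewrite /incr /incrs; clear; lia.
(* In the vanishing coefficient, taking [v] from the edge [vw] gives the nonzero coefficient of
   [eta]. So taking [w] gives a nonzero one as well, still with exponent 1 at [v], which another
   edge [vu] must supply. *)
have [u uU0 nzu] : exists2 u, u \in enum U0 & coef L' (incr (decr eta w) u) <> 0%R.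
  apply: (@coef_push1 _ v) => //.
    by rewrite /decr (negbTE vw') ev.
  move: D0; rewrite /= w0 incr_gt0 incrK coef_push // => /eqP; rewrite subr_eq0 => /eqP D0.
  rewrite -[X in coef _ X](_ : decr (incr (incrs eta (enum U0)) v) w = _) ?D0 //.
  apply: funext => z; rewrite /decr /incr !incrs_enum.
  case: (eqVneq z w) => [->|_]; first by rewrite eq_sym (negbTE vw') (negbTE wU0) !addn0.
  by rewrite !subn0.
have [uw uU] : u != w /\ u \in U by move: uU0; rewrite mem_enum in_setD1 => /andP[].
apply: (incr_bounds _ _ _ _ _ nzu).
- move=> z zU; have := bU _ zU; rewrite /incr /decr.
  by case: (z == u); case: (z == w) => /=; clear; lia.
- by rewrite /incr /decr ev (negbTE vw') /=; case: eqP vU => // ->; rewrite uU.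
- move=> z zU; rewrite /incr /decr.
  have -> : z == u = false by apply: contraNF zU => /eqP ->.
  have -> : z == w = false by apply: contraNF zU => /eqP ->.
  by rewrite subn0 addn0.
- move=> z /XE ->; rewrite /incr /decr eqxx [w == u]eq_sym (negbTE uw).
  by have := b2' _ wB wv; move: ew; clear; lia.
Qed.

(** The parts are the component [C] of [p] with [x] and [y] added, and [S] without [C]. The first
    lacks [q] and the second [p], so both are smaller. As no edge crosses, [v1v2] lies in one part,
    which takes the first place in the split. *)
Lemma nice2_splittable Z S v1 v2 :
    (forall S', #|S'| < #|S| -> forall a b, a \in bd Z S' -> b \in bd Z S' ->
       e a b -> S' \subset S -> nice2 Z S' a b) ->
    v1 \in bd Z S -> v2 \in bd Z S -> e v1 v2 -> splittable e Z S ->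
  nice2 Z S v1 v2.
Proof.
move=> IH bv1 bv2 e12 [x [y [p [q [[bx by'] xy pT qT npq]]]]].
set T := S :\: [set x; y] in pT qT npq.
pose C := component e T p.
have CT : C \subset T := component_sub e pT.
have pC : p \in C := mem_component _ _ _.
have qC : q \notin C by rewrite inE.
have closedC u v : u \in C -> v \in T -> e u v -> v \in C.
  move=> uC vT uv; exact: (component_closed (subsetP CT _ uC) uC vT uv).
clearbody C.
pose S1 := [set x; y] :|: C; pose S2 := S :\: C.
have mS1 z : (z \in S1) = (z == x) || (z == y) || (z \in C) by rewrite !inE.
have mS2 z : (z \in S2) = (z \notin C) && (z \in S) by rewrite !inE.
have mT z : (z \in T) = ~~ ((z == x) || (z == y)) && (z \in S) by rewrite !inE.
have xyC z : (z == x) || (z == y) -> z \notin C.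
  by move=> zxy; apply/negP => /(subsetP CT); rewrite mT zxy.
have S12 : S1 :|: S2 = S.
  apply/setP => z; rewrite in_setU mS1 mS2.
  case: (boolP ((z == x) || (z == y))) => [/orP[] /eqP ->|_] /=; rewrite ?(bdS bx) ?(bdS by') //.
  case: (boolP (z \in C)) => //= /(subsetP CT); by rewrite mT => /andP[_ ->].
have SI : S1 :&: S2 = [set x; y].
  apply/setP => z; rewrite in_setI mS1 mS2 in_set2.
  case: (boolP ((z == x) || (z == y))) => [zxy|_] /=; last by case: (z \in C).
  by rewrite xyC //=; case/orP: zxy => /eqP ->; rewrite ?(bdS bx) ?(bdS by').
have noe u v : u \in S1 -> v \in S2 -> e u v -> (u \in S2) || (v \in S1).
  rewrite !mS1 !mS2 => + /andP[vC vS] uv.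
  case/orP => [uxy|uC].
    by rewrite xyC //=; case/orP: uxy => /eqP ->; rewrite ?(bdS bx) ?(bdS by').
  case: (boolP ((v == x) || (v == y))) => vxy; rewrite ?orbT //.
  case/negP: vC; apply: (closedC _ _ uC _ uv).
  by rewrite mT vxy.
have noe' u v : u \in S2 -> v \in S1 -> e u v -> (u \in S1) || (v \in S2).
  by rewrite orbC eC => u2 v1'; apply: noe.
have sub1 : S1 \subset S by rewrite -S12 subsetUl.
have sub2 : S2 \subset S by rewrite -S12 subsetUr.
have lt1 : #|S1| < #|S|.
  apply: proper_card; apply/properP; split=> //; exists q.
    by move: qT; rewrite mT => /andP[].
  by rewrite mS1 negb_or qC andbT; move: qT; rewrite mT => /andP[].
have lt2 : #|S2| < #|S|.
  apply: proper_card; apply/properP; split=> //; exists p.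
    by move: pT; rewrite mT => /andP[].
  by rewrite mS2 pC.
have bdT (S' : {set W}) z : z \in bd Z S -> z \in S' -> z \in bd Z S'.
  by move=> /setIP[_ zZ] zS'; rewrite inE zS'.
have [[x1 x2] [y1 y2]] : (x \in S1 /\ x \in S2) /\ (y \in S1 /\ y \in S2).
  have : x \in S1 :&: S2 by rewrite SI !inE eqxx.
  have : y \in S1 :&: S2 by rewrite SI !inE eqxx orbT.
  by rewrite !in_setI => /andP[] ? ? /andP[].
have [/andP[a1 a2]|n1] := boolP ((v1 \in S1) && (v2 \in S1)).
  apply: (nice2_split xy S12 SI noe) => //; apply: IH => //; exact: bdT.
have [/andP[a1 a2]|n2] := boolP ((v1 \in S2) && (v2 \in S2)).
  rewrite setUC in S12; rewrite setIC in SI.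
  apply: (nice2_split xy S12 SI noe') => //; apply: IH => //; exact: bdT.
have mS z : z \in bd Z S -> (z \in S1) || (z \in S2).
  by move=> /bdS; rewrite -{1}S12 => /setUP[->|->]; rewrite ?orbT.
exfalso; have := mS _ bv1; have := mS _ bv2.
have := noe v1 v2; have := noe v2 v1; rewrite [e v2 v1]eC e12.
move: n1 n2; do ![case: (_ \in _) => //=] => _ _ h1 h2 _ _;
  by (have := h1 isT isT isT) || (have := h2 isT isT isT).
Qed.

Hypothesis noK5 : forall s, ~~ K5_model e s.
Hypothesis noK33 : forall s t, ~~ K33_model e s t.

(** A boundary vertex with three boundary neighbours yields a split, so all have at most two. If
    [B'] is nonempty, either some vertex has at most one neighbour inside [B'] and can be removed,
    or [B'] contains a cycle, which misses [v1] and again yields a split. *)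
Lemma nice2_step Z S v1 v2 : conn e Z -> [disjoint Z & S] ->
    (forall Z' S', #|S'| < #|S| -> conn e Z' -> [disjoint Z' & S'] ->
      (forall a b, a \in bd Z' S' -> b \in bd Z' S' -> e a b -> nice2 Z' S' a b)
      /\ (forall a, a \in bd Z' S' -> nice1 Z' S' a)) ->
    v1 \in bd Z S -> v2 \in bd Z S -> e v1 v2 ->
  nice2 Z S v1 v2.
Proof.
move=> cZ dZ IH b1 b2 e12.
have v12 : v1 != v2 by apply: contraTneq e12 => ->; rewrite eirr.
have nsplit : splittable e Z S -> nice2 Z S v1 v2.
  apply: nice2_splittable => // S' lt a b ba bb ab sS'.
  have [|h _] := IH Z S' lt cZ; last exact: h.
  by rewrite disjoint_sym (disjointWl sS') // disjoint_sym.
pose B' := bd Z S :\: [set v1; v2].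
have [B0|Bn0] := eqVneq B' set0.
  have lt : #|S :\ v1| < #|S| by rewrite [#|S|](cardsD1 v1) (bdS b1).
  apply: nice2_base => //; first exact: (bdS b1).
    move=> w wB; have := in_set0 w; rewrite -B0 in_setD wB andbT in_set2.
    by move/negbFE.
  have [||_] := IH [set v1] _ lt; first exact: conn1.
    by rewrite disjoints1 !inE eqxx.
  by apply; rewrite inE nbhd1 e12 in_setD1 eq_sym v12 (bdS b2).
have [/existsP[v /andP[vB c3]]|deg2] :=
  boolP [exists v, (v \in bd Z S) && (2 < #|[set w in bd Z S | e v w]|)].
  have /card_gt2P[a [b [c [[+ + +] [ab bc ca]]]]] := c3.
  move=> /setIdP[aB va] /setIdP[bB vb] /setIdP[cB vc]; apply: nsplit.
  apply: (@three_bd_nbrs _ _ eC eirr noK5 noK33 _ _ cZ dZ v a b c) => //.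
  by rewrite eq_sym.
have {}deg2 v : v \in bd Z S -> #|[set w in bd Z S | e v w]| <= 2.
  move=> vB; move: deg2; rewrite negb_exists => /forallP /(_ v).
  by rewrite vB /= -leqNgt.
have [/existsP[v /andP[vB' d1]]|deg1] :=
  boolP [exists v, (v \in B') && (#|[set w in B' | e v w]| <= 1)].
  have [vB vv1 vv2] : [/\ v \in bd Z S, v != v1 & v != v2].
    by move: vB'; rewrite in_setD in_set2 negb_or => /andP[/andP[]].
  apply: (@nice2_remove _ _ v) => //; first exact: deg2.
    apply: leq_trans d1; apply: subset_leq_card; apply/subsetP => w.
    by rewrite !inE negb_or => /andP[-> /and3P[-> -> ->]].
  have lt : #|S :\ v| < #|S| by rewrite [#|S|](cardsD1 v) (bdS vB).
  have [||h _] := IH (v |: Z) _ lt.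
  - apply: connU => //; first exact: conn1.
    by rewrite adjsC //; apply: (adjs_bd vB); rewrite inE.
  - rewrite disjoint_subset; apply/subsetP => z /setU1P[->|zZ]; rewrite !inE ?eqxx //.
    by rewrite (disjointFr dZ zZ) andbF.
  have bdR z : z \in bd Z S -> z != v -> z \in bd (v |: Z) (S :\ v).
    by move=> /setIP[zS zZ] zv; rewrite inE in_setD1 zv zS nbhdU1 zZ orbT.
  by apply: h => //; apply: bdR; rewrite // eq_sym.
have [c [cc uc sc cB]] : exists c, [/\ cycle e c, uniq c, 2 < size c & {subset c <= B'}].
  apply: min_degree2_cycle => // v vB; move: deg1; rewrite negb_exists => /forallP /(_ v).
  by rewrite vB /= -ltnNge.
apply: nsplit; apply: (@cycle_in_bd _ _ eC noK5 noK33 _ _ cZ dZ v1 c) => //.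
  by move=> z /cB; rewrite in_setD => /andP[].
by apply/negP => /cB; rewrite !inE eqxx.
Qed.

(** The claims feed each other: [nice2] falls back on [nice1] when [v1] replaces [Z], [nice1] on
    [nice0] when the marked vertex has no boundary neighbour, and otherwise on [nice2] by restoring
    the deleted edge. *)
Lemma nice_exists n : forall Z S, #|S| <= n -> conn e Z -> [disjoint Z & S] ->
  [/\ forall a b, a \in bd Z S -> b \in bd Z S -> e a b -> nice2 Z S a b,
      forall a, a \in bd Z S -> nice1 Z S a & nice0 Z S].
Proof.
elim: n => [|n IH] Z S hS cZ dZ.
  have S0 : S = set0 by apply/eqP; rewrite -cards_eq0 -leqn0.
  rewrite S0; split=> [a b|a|]; try by rewrite !inE.
  exists (fun=> 0), [::]; split=> //.
    by split=> // x y; rewrite /restr !inE.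
  by rewrite /=; case: forallP.
have N2 a b : a \in bd Z S -> b \in bd Z S -> e a b -> nice2 Z S a b.
  apply: nice2_step => // Z' S' lt cZ' dZ'.
  by have [|//|//|] := IH Z' S' => //; lia.
have rem v : v \in S -> #|S :\ v| <= n.
  by move=> vS; move: hS; rewrite (cardsD1 v S) vS; lia.
have N1 v : v \in bd Z S -> nice1 Z S v.
  move=> vB; have vS := bdS vB.
  have [/existsP[w /andP[wB vw]]|nw] := boolP [exists w, (w \in bd Z S) && e v w].
    by apply: (nice1_of_nice2 _ _ vw); [|exact: (bdS wB)|exact: N2].
  have [|||_ _ h0] := IH (v |: Z) (S :\ v); first exact: rem.
  - apply: connU => //; first exact: conn1.
    by rewrite adjsC //; apply: (adjs_bd vB); rewrite inE.
  - rewrite disjoint_subset; apply/subsetP => z /setU1P[->|zZ]; rewrite !inE ?eqxx //.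
    by rewrite (disjointFr dZ zZ) andbF.
  apply: (nice0_push vS h0).
    by move=> w wS vw; rewrite nbhdU1 vw.
  move=> w wB wv; rewrite nbhdU1 (setIP wB).2 orbT; split=> //.
  by move: nw; rewrite negb_exists => /forallP /(_ w); rewrite wB.
split=> //.
have [B0|/set0Pn[v vB]] := eqVneq (bd Z S) set0; last first.
  by have [eta [L [h _]]] := N1 _ vB; exists eta, L.
have [S0|/set0Pn[v vS]] := eqVneq S set0.
  exists (fun=> 0), [::]; split=> //.
    by rewrite S0; split=> // x y; rewrite /restr !inE.
  by rewrite /=; case: forallP.
(* No vertex of [S] sees [Z], as can happen in a disconnected graph; any vertex of [S] serves as the
   new [Z]. *)
have [|||_ _ h0] := IH [set v] (S :\ v); first exact: rem.
- exact: conn1.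
- by rewrite disjoints1 !inE eqxx.
have [||eta [L [h _]]] := @nice0_push Z [set v] S v vS h0.
- by move=> w wS vw; rewrite nbhd1.
- by move=> w; rewrite B0 inE.
by exists eta, L.
Qed.

End NiceIndexFunctions.

(** * Crossing parity *)

Section Crossings.
Variable R : realFieldType.
Implicit Types (p q x y : R * R) (s t : seq (R * R)).
Local Open Scope ring_scope.

(** An open half-plane with half of its bounding line: it contains exactly one of [p] and [- p]
    unless [p] is 0. *)
Definition upper p := (0 < p.2) || ((p.2 == 0) && (0 < p.1)).

(* Detects a short step from [p] to [q] across the positive first half-axis. *)
Definition cross p q := (upper p (+) upper q) && (0 < p.1).

Variable delta : R.

Definition dclose p q := (`|p.1 - q.1| < delta) && (`|p.2 - q.2| < delta).
(** The factor 2 allows both points to move by one step while the coordinate in which they are far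
    keeps its sign. *)
Definition dfar p q := (2 * delta <= `|p.1 - q.1|) || (2 * delta <= `|p.2 - q.2|).

Lemma dcloseP p q : dclose p q ->
  [/\ p.1 - q.1 < delta, q.1 - p.1 < delta, p.2 - q.2 < delta & q.2 - p.2 < delta].
Proof.
by rewrite /dclose !ltr_norml => /andP[/andP[h1 h2] /andP[h3 h4]]; split; lra.
Qed.

Lemma dfarP p q : dfar p q ->
  [\/ 2 * delta <= p.1 - q.1, 2 * delta <= q.1 - p.1,
      2 * delta <= p.2 - q.2 | 2 * delta <= q.2 - p.2].
Proof.
rewrite /dfar !ler_normr => /orP[] /orP[] h.
- by constructor 1.
- by constructor 2; lra.
- by constructor 3.
- by constructor 4; lra.
Qed.

Lemma upper_pos p : 0 < p.2 -> upper p.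
Proof. by rewrite /upper => ->. Qed.

Lemma upper_neg p : p.2 < 0 -> upper p = false.
Proof. by move=> h; rewrite /upper lt_gtF // lt_eqF. Qed.

(** The far coordinate has the same sign at all four corners. If it is the first one, either nothing
    crosses or every change of [upper] counts, and these cancel around the square; if it is the
    second, [upper] is constant. *)
Lemma cross_square p p' q q' : dclose p p' -> dclose q q' -> dfar p q ->
  cross (p - q) (p' - q) (+) cross (p - q') (p' - q')
    (+) cross (p - q) (p - q') (+) cross (p' - q) (p' - q') = false.
Proof.
move=> /dcloseP[a1 a2 a3 a4] /dcloseP[b1 b2 b3 b4] /dfarP[] h.
- rewrite /cross.
  have [-> -> ->] : [/\ 0 < (p - q).1, 0 < (p - q').1 & 0 < (p' - q).1].
    by rewrite /=; split; lra.
  rewrite !andbT; case: (upper (p - q)); case: (upper (p' - q));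
  by case: (upper (p - q')); case: (upper (p' - q')).
- rewrite /cross.
  have [h1 h2 h3] : [/\ (p - q).1 <= 0, (p - q').1 <= 0 & (p' - q).1 <= 0].
    by rewrite /=; split; lra.
  by rewrite !(le_gtF h1, le_gtF h2, le_gtF h3) !andbF.
- rewrite /cross !upper_pos //=; lra.
- rewrite /cross !upper_neg //=; lra.
Qed.

(** A change of [upper] happens at the positive or at the negative half-axis, and the antipodal map
    exchanges the two; so the two crossings together count each change once. *)
Lemma cross_opp p q q' : dclose q q' -> dfar p q ->
  cross (p - q) (p - q') = cross (q - p) (q' - p) (+) (upper (q - p) (+) upper (q' - p)).
Proof.
have upN r r' : r != r' -> upper (r - r') = ~~ upper (r' - r).
  case: r r' => [r1 r2] [s1 s2]; rewrite xpair_eqE /upper /= !subr_gt0 !subr_eq0.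
  by rewrite [s2 == r2]eq_sym; case: (ltgtP r2 s2) => //= _; case: (ltgtP r1 s1).
move=> /dcloseP[b1 b2 b3 b4] /dfarP h.
have [n1 n2] : p != q /\ p != q'.
  by split; apply/eqP => pq; rewrite pq in h; case: h => h; lra.
rewrite /cross (upN p q) // (upN p q') //.
have [e|e] := eqVneq (upper (q - p)) (upper (q' - p)).
  by rewrite e !addbb.
have -> : ~~ upper (q - p) (+) ~~ upper (q' - p) = true.
  by move: e; case: (upper (q - p)); case: (upper (q' - p)).
have -> : upper (q - p) (+) upper (q' - p) = true.
  by move: e; case: (upper (q - p)); case: (upper (q' - p)).
rewrite /= addbT; case: h => h.
- have -> : 0 < p.1 - q.1 by lra.
  by rewrite lt_gtF //; lra.
- have -> : 0 < q.1 - p.1 by lra.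
  by rewrite lt_gtF //; lra.
- by move: e; rewrite !upper_neg ?eqxx //=; lra.
- by move: e; rewrite !upper_pos ?eqxx //=; lra.
Qed.

Fixpoint crossings (f : R * R -> R * R) x s : bool :=
  if s is y :: s' then cross (f x) (f y) (+) crossings f y s' else false.

Lemma crossings_strip x x' y t : dclose x x' -> path dclose y t ->
    {in y :: t, forall q, dfar x q} ->
  cross (x - y) (x' - y) (+) cross (x - last y t) (x' - last y t)
    (+) crossings (fun q => x - q) y t (+) crossings (fun q => x' - q) y t = false.
Proof.
move=> xx'; elim: t y => [|z t IH] y /=; first by rewrite addbb.
move=> /andP[yz pt] h.
have {}IH : cross (x - z) (x' - z) (+) cross (x - last z t) (x' - last z t)
    (+) crossings (fun q => x - q) z t (+) crossings (fun q => x' - q) z t = false.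
  by apply: IH => // q qt; apply: h; rewrite inE qt orbT.
have := cross_square xx' yz (h _ (mem_head _ _)).
move: IH; case: (cross (x - y) _); case: (cross (x - z) (x' - z));
case: (cross (x - last z t) _); case: (cross (x - y) _);
case: (cross (x' - y) _); case: (crossings _ z t); by case: (crossings _ z t).
Qed.

Lemma crossings_rect x s y t : path dclose x s -> path dclose y t ->
    {in x :: s & y :: t, forall p q, dfar p q} ->
  crossings (fun p => p - y) x s (+) crossings (fun p => p - last y t) x s
    (+) crossings (fun q => x - q) y t
    (+) crossings (fun q => last x s - q) y t = false.
Proof.
move=> + pt; elim: s x => [|z s IH] x /=; first by rewrite addbb.
move=> /andP[xz ps] h.
have {}IH : crossings (fun p => p - y) z s (+) crossings (fun p => p - last y t) z s
    (+) crossings (fun q => z - q) y t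
    (+) crossings (fun q => last z s - q) y t = false.
  by apply: IH => // p q ps' qt; apply: h; rewrite // inE ps' orbT.
have := crossings_strip xz pt (fun q qt => h x q (mem_head _ _) qt).
move: IH; case: (cross (x - y) _); case: (cross (x - last y t) _);
case: (crossings _ z s); case: (crossings _ z s);
case: (crossings (fun q => z - q) y t); case: (crossings (fun q => x - q) y t);
by case: (crossings _ y t).
Qed.

Lemma crossings_opp x y t : path dclose y t -> {in y :: t, forall q, dfar x q} ->
  crossings (fun q => x - q) y t =
  crossings (fun q => q - x) y t (+) (upper (y - x) (+) upper (last y t - x)).
Proof.
elim: t y => [|z t IH] y /=; first by rewrite addbb.
move=> /andP[yz pt] h; rewrite IH //; last first.
  by move=> q qt; apply: h; rewrite inE qt orbT.
rewrite cross_opp //; last exact: h (mem_head _ _).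
case: (cross _ _); case: (crossings _ z t); case: (upper (y - x));
by case: (upper (z - x)); case: (upper (last z t - x)).
Qed.

(** The parity of the crossings with the ray that leaves [v] along the first axis. *)
Definition winds (v : R * R) x s := crossings (fun p => p - v) x s.

Local Notation zb b := (Posz (nat_of_bool b)).

(** Each side of the square becomes one chain seen from an end of the other; two sides need the
    antipodal map, which leaves the [upper] terms. Evenness over the integers makes the final count
    linear arithmetic. *)
Lemma winds_pair x s y t : path dclose x s -> path dclose y t ->
    {in x :: s & y :: t, forall p q, dfar p q} ->
  exists k : int, (zb (winds y x s) + zb (winds (last y t) x s)
     + zb (winds x y t) + zb (winds (last x s) y t)
     + zb (upper (y - x)) + zb (upper (last y t - x))
     + zb (upper (y - last x s)) + zb (upper (last y t - last x s)) = 2 * k).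
Proof.
move=> ps pt h; have := crossings_rect ps pt h.
rewrite !crossings_opp // /winds; try by move=> q qt; apply: h; rewrite ?mem_head ?mem_last.
set b1 := crossings _ x s; set b2 := crossings _ x s.
set b3 := crossings _ y t; set b4 := crossings _ y t.
set u1 := upper _; set u2 := upper _; set u3 := upper _; set u4 := upper _.
clear; case: b1; case: b2; case: b3; case: b4; case: u1; case: u2; case: u3; case: u4 => //= _;
  by [exists 0|exists 1|exists 2|exists 3|exists 4].
Qed.

Lemma upper_oppz x y : x != y -> zb (upper (x - y)) = 1 - zb (upper (y - x)).
Proof.
case: x y => [r1 r2] [s1 s2]; rewrite xpair_eqE /upper /= !subr_gt0 !subr_eq0.
by rewrite [s2 == r2]eq_sym; case: (ltgtP r2 s2) => //= _; case: (ltgtP r1 s1).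
Qed.

End Crossings.

(** [n v i j] stands for the chain [ij] seen from [v], and [h] for [upper]. Over the 15 pairs of
    disjoint edges each [n] occurs twice and each pair of vertices 6 times in [h]. Sorting the
    arguments of [h] leaves the constant 4 + 3 + 2 for every four vertices, 45 in all, which is
    odd. *)
Lemma K5_parity (n : nat -> nat -> nat -> int) (h : nat -> nat -> int) :
    (forall i j, i < j < 5 -> h j i = (1 - h i j)%R) ->
    (forall i j k l, i < j < 5 -> i < k -> k < l < 5 -> j != k -> j != l ->
      exists m, (n k i j + n l i j + n i k l + n j k l
        + h k i + h l i + h k j + h l j = 2 * m)%R) ->
  False.
Proof.
move=> hO E.
have [m0 E0] := E 0 1 2 3 isT isT isT isT isT.
have [m1 E1] := E 0 1 2 4 isT isT isT isT isT.
have [m2 E2] := E 0 1 3 4 isT isT isT isT isT.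
have [m3 E3] := E 0 2 1 3 isT isT isT isT isT.
have [m4 E4] := E 0 2 1 4 isT isT isT isT isT.
have [m5 E5] := E 0 2 3 4 isT isT isT isT isT.
have [m6 E6] := E 0 3 1 2 isT isT isT isT isT.
have [m7 E7] := E 0 3 1 4 isT isT isT isT isT.
have [m8 E8] := E 0 3 2 4 isT isT isT isT isT.
have [m9 E9] := E 0 4 1 2 isT isT isT isT isT.
have [m10 E10] := E 0 4 1 3 isT isT isT isT isT.
have [m11 E11] := E 0 4 2 3 isT isT isT isT isT.
have [m12 E12] := E 1 2 3 4 isT isT isT isT isT.
have [m13 E13] := E 1 3 2 4 isT isT isT isT isT.
have [m14 E14] := E 1 4 2 3 isT isT isT isT isT.
have F01 := hO 0 1 isT.
have F02 := hO 0 2 isT.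
have F03 := hO 0 3 isT.
have F04 := hO 0 4 isT.
have F12 := hO 1 2 isT.
have F13 := hO 1 3 isT.
have F14 := hO 1 4 isT.
have F23 := hO 2 3 isT.
have F24 := hO 2 4 isT.
have F34 := hO 3 4 isT.
clear E hO; lia.
Qed.

(** Over the 18 pairs of disjoint edges each [n] occurs twice, and a pair of vertices occurs in [h]
    6 times if on the same side, 4 times otherwise. Sorting the arguments of [h] leaves the odd
    constant 36 + 9. *)
Lemma K33_parity (n : nat -> nat -> nat -> int) (h : nat -> nat -> int) :
    (forall i j, i < j < 6 -> h j i = (1 - h i j)%R) ->
    (forall i j k l, i < k < 3 -> 2 < j < 6 -> 2 < l < 6 -> j != l ->
      exists m, (n k i j + n l i j + n i k l + n j k l
        + h k i + h l i + h k j + h l j = 2 * m)%R) ->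
  False.
Proof.
move=> hO E.
have [m0 E0] := E 0 3 1 4 isT isT isT isT.
have [m1 E1] := E 0 3 1 5 isT isT isT isT.
have [m2 E2] := E 0 4 1 3 isT isT isT isT.
have [m3 E3] := E 0 4 1 5 isT isT isT isT.
have [m4 E4] := E 0 5 1 3 isT isT isT isT.
have [m5 E5] := E 0 5 1 4 isT isT isT isT.
have [m6 E6] := E 0 3 2 4 isT isT isT isT.
have [m7 E7] := E 0 3 2 5 isT isT isT isT.
have [m8 E8] := E 0 4 2 3 isT isT isT isT.
have [m9 E9] := E 0 4 2 5 isT isT isT isT.
have [m10 E10] := E 0 5 2 3 isT isT isT isT.
have [m11 E11] := E 0 5 2 4 isT isT isT isT.
have [m12 E12] := E 1 3 2 4 isT isT isT isT.
have [m13 E13] := E 1 3 2 5 isT isT isT isT.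
have [m14 E14] := E 1 4 2 3 isT isT isT isT.
have [m15 E15] := E 1 4 2 5 isT isT isT isT.
have [m16 E16] := E 1 5 2 3 isT isT isT isT.
have [m17 E17] := E 1 5 2 4 isT isT isT isT.
have F01 := hO 0 1 isT.
have F02 := hO 0 2 isT.
have F03 := hO 0 3 isT.
have F04 := hO 0 4 isT.
have F05 := hO 0 5 isT.
have F12 := hO 1 2 isT.
have F13 := hO 1 3 isT.
have F14 := hO 1 4 isT.
have F15 := hO 1 5 isT.
have F34 := hO 3 4 isT.
have F35 := hO 3 5 isT.
have F45 := hO 4 5 isT.
clear E hO; lia.
Qed.

(** * Drawings by chains admit no [K5] or [K33] minor *)

Section Drawings.
Variables (R : realFieldType) (W : finType) (e : rel W).
Hypothesis eC : symmetric e.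
Variables (delta : R) (pos : W -> R * R) (chain : W -> W -> seq (R * R)).
Hypothesis pos_inj : injective pos.
Hypothesis chain_path : forall u w, e u w ->
  path (dclose delta) (pos u) (chain u w) /\ last (pos u) (chain u w) = pos w.
Hypothesis chain_far : forall u w u' w', e u w -> e u' w' ->
  u != u' -> u != w' -> w != u' -> w != w' ->
  {in pos u :: chain u w & pos u' :: chain u' w', forall p q, dfar delta p q}.

Definition drawn_in (A : {set W}) (p : R * R) :=
  exists u w, [/\ u \in A, w \in A, e u w & p \in pos u :: chain u w].

Lemma drawn_in_far (A B : {set W}) p q :
  [disjoint A & B] -> drawn_in A p -> drawn_in B q -> dfar delta p q.
Proof.
move=> dAB [u [w [uA wA uw pc]]] [u' [w' [uB wB uw' qc]]].
have ne a b : a \in A -> b \in B -> a != b.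
  by move=> aA bB; apply/eqP => ab; rewrite -ab (disjointFr dAB aA) in bB.
by apply: (chain_far uw uw') => //; apply: ne.
Qed.

Lemma connect_chain (A : {set W}) x y : x != y -> connect (restr e A) x y ->
  exists t, [/\ path (dclose delta) (pos x) t, last (pos x) t = pos y
              & forall p, p \in pos x :: t -> drawn_in A p].
Proof.
move=> xy /connectP[p pp ey]; rewrite ey in xy *; move: xy {ey}.
elim: p x pp => [|z p IH] x /=; first by rewrite eqxx.
move=> /andP[/and3P[xA zA xz] pz] _.
have [pc lc] := chain_path xz.
have dr q : q \in pos x :: chain x z -> drawn_in A q by exists x, z.
have [ez|nz] := eqVneq z (last z p).
  by exists (chain x z); rewrite -ez.
have [t [pt lt dt]] := IH z pz nz.
exists (chain x z ++ t); rewrite cat_path last_cat pc lc; split=> // q.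
rewrite -cat_cons mem_cat => /orP[/dr //|qt]; apply: dt.
by rewrite inE qt orbT.
Qed.

(** A vertex is picked in each branch set, and the chain of a model edge stays within the union of
    its two branch sets. Disjoint model edges thus only use disjoint edges of the graph, whose
    chains are far apart; model edges with a common end may overlap. *)
Lemma model_chains (s : seq {set W}) n (r : rel nat) : size s = n ->
    all (conn e) s -> pairwise (fun A B : {set W} => [disjoint A & B]) s ->
    (forall i j, r i j -> i < j < n /\ adjs e (nth set0 s i) (nth set0 s j)) ->
  exists (x : nat -> R * R) (T : nat -> nat -> seq (R * R)),
  [/\ forall i j, i < j < n -> x i != x j,
      forall i j, r i j -> path (dclose delta) (x i) (T i j) /\ last (x i) (T i j) = x j
    & forall i j k l, r i j -> r k l -> i != k -> i != l -> j != k -> j != l ->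
      {in x i :: T i j & x k :: T k l, forall p q, dfar delta p q}].
Proof.
move=> sz cs ds hr; set A := nth set0 s.
have cA i : i < n -> conn e (A i).
  by move=> lt; apply: (allP cs); rewrite mem_nth // sz.
have dA i j : i < n -> j < n -> i != j -> [disjoint A i & A j].
  move=> li lj; rewrite neq_ltn => /orP[] lt; last rewrite disjoint_sym.
    by apply: (pairwiseP set0 ds); rewrite // inE sz.
  by apply: (pairwiseP set0 ds); rewrite // inE sz.
have [n0|n0] := posnP n.
  exists (fun=> 0%R), (fun _ _ => [::]).
  by split=> [i j|i j /hr[]|i j k l /hr[]]; rewrite n0 ltn0 andbF.
have [x0 _] : exists x0, x0 \in A 0.
  by have /connP[/set0Pn] := cA 0 n0.
have : forall i, exists x, i < n -> x \in A i.
  move=> i; case: (ltnP i n) => h; last by exists x0.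
  by have /connP[/set0Pn[x xA] _] := cA i h; exists x.
move=> /choice[x xA].
have xN i j : i < n -> j < n -> i != j -> x i != x j.
  move=> li lj ij; apply/eqP => eij; have := disjointFr (dA i j li lj ij) (xA i li).
  by rewrite eij xA.
have : forall ij : nat * nat, exists t, r ij.1 ij.2 ->
    [/\ path (dclose delta) (pos (x ij.1)) t, last (pos (x ij.1)) t = pos (x ij.2)
              & forall p, p \in pos (x ij.1) :: t -> drawn_in (A ij.1 :|: A ij.2) p].
  move=> [i j] /=; case: (boolP (r i j)) => rij; last by exists [::].
  have [/andP[lij lj] aij] := hr _ _ rij.
  have li := ltn_trans lij lj.
  have [||t ht] := @connect_chain (A i :|: A j) (x i) (x j); last by exists t.
    by apply: xN => //; rewrite neq_ltn lij.
  have /connP[_] := connU eC (cA i li) (cA j lj) aij.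
  by apply; rewrite inE xA ?orbT.
move=> /choice[T hT].
exists (fun i => pos (x i)), (fun i j => T (i, j)); split.
- move=> i j /andP[lij lj]; rewrite (inj_eq pos_inj) xN ?(ltn_trans lij) //.
  by rewrite neq_ltn lij.
- by move=> i j rij; have [] := hT (i, j) rij.
move=> i j k l rij rkl ik il jk jl p q pi qk.
have [_ _ d1] := hT (i, j) rij; have [_ _ d2] := hT (k, l) rkl.
have [/andP[lij lj] _] := hr _ _ rij; have [/andP[lkl ll] _] := hr _ _ rkl.
have li := ltn_trans lij lj; have lk := ltn_trans lkl ll.
apply: drawn_in_far (d1 _ pi) (d2 _ qk) => /=.
rewrite disjoint_subset; apply/subsetP => z zij; rewrite inE in_setU negb_or.
by case/setUP: zij => z1; rewrite !(disjointFr (dA _ _ _ _ _) z1).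
Qed.

Lemma no_K5_model s : ~~ K5_model e s.
Proof.
apply/negP => /and4P[/eqP sz cs ds as_].
have [|x [T [xN pT fT]]] := @model_chains s 5 (fun i j => i < j < 5) sz cs ds.
  move=> i j ij; split=> //; case/andP: ij => ij j5.
  by apply: (pairwiseP set0 as_) => //; rewrite inE sz // (ltn_trans ij).
apply: (@K5_parity (fun v i j => Posz (winds (x v) (x i) (T i j)))
          (fun i j => Posz (upper (x i - x j)%R))).
  by move=> i j ij; apply: upper_oppz; rewrite eq_sym xN.
move=> i j k l ij ik kl jk jl; have [pi li] := pT _ _ ij; have [pk lk] := pT _ _ kl.
have il : i != l by rewrite neq_ltn (ltn_trans ik) //; case/andP: kl.
have ik' : i != k by rewrite neq_ltn ik.
have := winds_pair pi pk (fT _ _ _ _ ij kl ik' il jk jl).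
by rewrite li lk.
Qed.

Lemma no_K33_model s t : ~~ K33_model e s t.
Proof.
apply/negP => /and5P[/eqP ss /eqP st cs ds ast].
have [||x [T [xN pT fT]]] :=
  @model_chains (s ++ t) 6 (fun i j => (i < 3) && (2 < j < 6)) _ cs ds.
- by rewrite size_cat ss st.
- move=> i j /andP[i3 /andP[j2 j6]]; split; first by rewrite (leq_trans i3).
  rewrite !nth_cat ss i3 ltnNge j2 /=.
  have /allP/(_ (nth set0 s i)) := ast.
  rewrite mem_nth ?ss // => /(_ isT) /allP/(_ (nth set0 t (j - 3))).
  by rewrite mem_nth ?st; [apply|lia].
apply: (@K33_parity (fun v i j => Posz (winds (x v) (x i) (T i j)))
          (fun i j => Posz (upper (x i - x j)%R))).
  by move=> i j ij; apply: upper_oppz; rewrite eq_sym xN.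
move=> i j k l /andP[ik k3] j6 l6 jl.
have rij : (i < 3) && (2 < j < 6) by rewrite j6 (ltn_trans ik).
have rkl : (k < 3) && (2 < l < 6) by rewrite l6 k3.
have [pi li] := pT _ _ rij; have [pk lk] := pT _ _ rkl.
have [ik' il jk] : [/\ i != k, i != l & j != k] by split; lia.
have := winds_pair pi pk (fT _ _ _ _ rij rkl ik' il jk jl).
by rewrite li lk.
Qed.

End Drawings.

(** * Chains of points in the plane *)

(* Imported only here because classical sets shadow the names of finite sets. *)
From mathcomp Require Import all_classical all_reals topology normedtype.
Import numFieldNormedType.Exports.

Section PlaneTopology.
Local Open Scope classical_set_scope.
Local Open Scope ring_scope.
Variable R : realType.
Implicit Types (p q x y : R * R) (A B K M : set (R * R)) (d eps : R).

Lemma dclose_refl d p : 0 < d -> dclose d p p.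
Proof. by move=> d0; rewrite /dclose !subrr normr0 d0. Qed.

Lemma dcloseC d p q : dclose d p q = dclose d q p.
Proof. by rewrite /dclose distrC [X in _ && (X < _)]distrC. Qed.

Lemma dclose_le d d' p q : d <= d' -> dclose d p q -> dclose d' p q.
Proof. by move=> dd /andP[h1 h2]; rewrite /dclose !(lt_le_trans _ dd). Qed.

Lemma dclose_trans d d' x y z : dclose d x y -> dclose d' y z -> dclose (d + d') x z.
Proof.
move=> /dcloseP[a1 a2 a3 a4] /dcloseP[b1 b2 b3 b4].
by rewrite /dclose !ltr_norml; apply/andP; split; apply/andP; split; lra.
Qed.

Lemma nbhs_dcloseP x A :
  nbhs x A <-> exists2 d, 0 < d & forall y, dclose d x y -> A y.
Proof.
split=> [/nbhs_ballP[d d0 h]|[d d0 h]].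
  by exists d => // y /andP[h1 h2]; apply: h.
by apply/nbhs_ballP; exists d => // y [h1 h2]; apply: h; apply/andP.
Qed.

Lemma fin_eps (I : finType) (P : I -> R -> Prop) :
    (forall i d d', d' <= d -> P i d -> P i d') ->
    (forall i, exists2 d, 0 < d & P i d) ->
  exists2 d, 0 < d & forall i, P i d.
Proof.
move=> mon ex.
have /choice[f hf] : forall i, exists d, 0 < d /\ P i d.
  by move=> i; have [d] := ex i; exists d.
exists (\big[Num.min/1]_(i : I) f i).
  by elim/big_ind: _ => // [a b a0 b0|i _]; [rewrite lt_min a0|exact: (hf i).1].
move=> i; apply: mon (hf i).2; rewrite (bigD1 i) //=.
by rewrite ge_min lexx.
Qed.

(** The class of [x] and the rest of [K] are both relatively open, so connectedness leaves no
    rest. *)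
Lemma connected_equiv K (r : R * R -> R * R -> Prop) : connected K ->
    (forall x y, r x y -> r y x) ->
    (forall x y z, r x y -> r y z -> r x z) ->
    (forall x, K x -> exists2 d, 0 < d & forall y, K y -> dclose d x y -> r x y) ->
  forall x y, K x -> K y -> r x y.
Proof.
move=> cK rC rT rl x y Kx Ky.
pose B := K `&` [set z | r x z].
suff BK : B = K.
  have : B y by rewrite BK.
  by case.
have open_r (P : set (R * R)) : (forall z, K z -> P z -> forall w, r z w -> P w) ->
    exists2 C, open C & K `&` P = K `&` C.
  move=> hP; pose C := \bigcup_(z in K `&` P) [set w | exists2 d, 0 < d &
     dclose d z w /\ forall y, K y -> dclose d z y -> r z y].
  exists C.
    rewrite openE => w [z [Kz Pz] /= [d d0 [zw h]]]; apply/nbhs_dcloseP.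
    have [h1 h2] := andP zw.
    have [e1 e2] : (0 < d - `|z.1 - w.1|) /\ (0 < d - `|z.2 - w.2|).
      by rewrite !subr_gt0.
    exists (Num.min (d - `|z.1 - w.1|) (d - `|z.2 - w.2|)).
      by rewrite lt_min e1.
    move=> w' /andP[c1 c2]; exists z => //; exists d => //; split=> //.
    move: c1 c2; rewrite !lt_min => /andP[c1 _] /andP[_ c2].
    apply/andP; split.
      by apply: le_lt_trans (ler_distD w.1 _ _) _; lra.
    by apply: le_lt_trans (ler_distD w.2 _ _) _; lra.
  apply/seteqP; split=> w [Kw hw]; split=> //.
    have [d d0 h] := rl _ Kw.
    by exists w => //; exists d => //; split=> //; apply: dclose_refl.
  case: hw => z [Kz Pz] [d d0 [zw h]].
  by apply: hP Kz Pz _ _; apply: h.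
apply: cK.
- exists x; split=> //=; have [d d0 h] := rl _ Kx.
  by apply: h => //; apply: dclose_refl.
- by apply: open_r => z Kz /= xz w zw; apply: rT zw.
have [C oC eC] : exists2 C, open C & K `&` [set z | ~ r x z] = K `&` C.
  by apply: open_r => z Kz /= nz w zw xw; apply: nz; apply: rT xw (rC _ _ zw).
exists (~` C); first exact: open_closedC.
apply/seteqP; split=> z [Kz hz]; split=> //.
  by move=> Cz; have [_] : (K `&` [set z | ~ r x z]) z by rewrite eC.
by apply: contrapT => nz; apply: hz; have [] : (K `&` C) z by rewrite -eC.
Qed.

(** Chains stand in for paths: a connected set has them for every step [d], path-connected or
    not. *)
Definition reach M d x y := exists s,
  [/\ path (dclose d) x s, last x s = y & forall p, p \in x :: s -> M p].

Lemma reach_sub M M' d x y : M `<=` M' -> reach M d x y -> reach M' d x y.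
Proof. by move=> sM [s [ps ls hs]]; exists s; split=> // p /hs /sM. Qed.

Lemma reach_trans M d x y z : reach M d x y -> reach M d y z -> reach M d x z.
Proof.
move=> [s [ps ls hs]] [t [pt lt ht]]; exists (s ++ t).
rewrite cat_path last_cat ls ps; split=> // p.
rewrite -cat_cons mem_cat => /orP[/hs //|pt'].
by apply: ht; rewrite inE pt' orbT.
Qed.

Lemma reach_sym M d x y : reach M d x y -> reach M d y x.
Proof.
move=> [s [ps ls hs]]; exists (rev (belast x s)); split.
- by rewrite -ls rev_path (eq_path (e' := dclose d)) // => p q; rewrite dcloseC.
- by case: s ps ls hs => [|z s] //= _ _ _; rewrite rev_cons last_rcons.
move=> p hp; apply: hs; move: hp; rewrite -ls inE mem_rev => /orP[/eqP ->|].
  exact: mem_last.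
by move/mem_belast.
Qed.

Lemma connected_reach K d x y : 0 < d -> connected K -> K x -> K y -> reach K d x y.
Proof.
move=> d0 cK Kx Ky; apply: (connected_equiv (K := K)) => //.
- by move=> *; apply: reach_sym.
- by move=> u v w; apply: reach_trans.
move=> u Ku; exists d => // v Kv uv; exists [:: v]; split=> //=; first by rewrite uv.
by move=> p; rewrite !inE => /orP[] /eqP ->.
Qed.

Lemma segment_reach M d x y : 0 < d ->
  (forall t, 0 <= t <= 1 -> M (x + t *: (y - x))) -> reach M d x y.
Proof.
move=> d0 hM; pose f (t : R) : R * R := x + t *: (y - x).
have h t : `[0, 1]%classic t -> M (f t).
  by rewrite /= in_itv /=; apply: hM.
apply: (@reach_sub (f @` `[0, 1])); first by move=> _ [t /h ht <-].
apply: connected_reach => //.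
- apply: connected_continuous_connected; first exact: segment_connected.
  apply: continuous_subspaceT => t.
  apply: cvgD; first exact: cvg_cst.
  by apply: cvgZr_tmp; exact: cvg_id.
- by exists 0; rewrite /= ?in_itv /= ?lexx ?ler01 // /f scale0r addr0.
- by exists 1; rewrite /= ?in_itv /= ?lexx ?ler01 // /f scale1r addrC subrK.
Qed.

Lemma arc_compact x y A : is_arc x y A -> compact A.
Proof.
move=> [g [cg _ _ _ <-]]; apply: continuous_compact => //.
exact: segment_compact.
Qed.

Lemma arc_connected x y A : is_arc x y A -> connected A.
Proof.
move=> [g [cg _ _ _ <-]]; apply: connected_continuous_connected => //.
exact: segment_connected.
Qed.

Lemma arc_ends x y A : is_arc x y A -> A x /\ A y.
Proof.
move=> [g [_ _ <- <- <-]]; split.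
  by exists 0; rewrite //= in_itv /= lexx ler01.
by exists 1; rewrite //= in_itv /= lexx ler01.
Qed.

Lemma closed_sep x A : closed A -> ~ A x ->
  exists2 d, 0 < d & forall q, A q -> ~ dclose d x q.
Proof.
move=> cA nA; have : nbhs x (~` A) by apply: open_nbhs_nbhs; split=> //; exact: closed_openC.
by move=> /nbhs_dcloseP[d d0 h]; exists d => // q Aq /h; apply.
Qed.

Lemma compact_sep A B : compact A -> closed B -> A `&` B = set0 ->
  exists2 d, 0 < d & forall p q, A p -> B q -> ~ dclose d p q.
Proof.
move=> cA cB AB.
have /compact_near_coveringP ncA := cA.
have [d /= d0 h] : \forall d \near 0^'+, A `<=` [set p | forall q, B q -> ~ dclose d p q].
  apply: ncA => p Ap.
  have nBp : ~ B p by move=> Bp; have : (A `&` B) p by []; rewrite AB.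
  have [eps e0 he] := closed_sep cB nBp.
  exists ([set p' | dclose (eps / 2) p p'], [set d | d <= eps / 2]).
    split=> /=.
      by apply/nbhs_dcloseP; exists (eps / 2) => //; lra.
    by near=> d; near: d; apply: nbhs_right_le; lra.
  move=> [p' d] /= [pp' de] q Bq /(dclose_le de) pq; apply: he Bq _.
  by have := dclose_trans pp' pq; rewrite -splitr.
exists (d / 2); first by lra.
move=> p q Ap Bq; apply: h => //=; last by lra.
by rewrite sub0r normrN gtr0_norm; lra.
Unshelve. all: by end_near.
Qed.

End PlaneTopology.

(** * The outer face *)

Section OuterFace.
Local Open Scope classical_set_scope.
Local Open Scope ring_scope.
Variables (R : realType) (V : finType) (G : plane_graph R V).
Implicit Types (p q x y : R * R) (d eta rho : R) (u v w : V).

Lemma plane_hausdorff : hausdorff_space (R * R)%type.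
Proof. exact: norm_hausdorff. Qed.

Lemma curve_closed u v : adj G u v -> closed (edge_curve G u v).
Proof.
move=> uv; apply: compact_closed; first exact: plane_hausdorff.
exact: arc_compact (curve_arc uv).
Qed.

Lemma pos_closed w : closed [set pos G w].
Proof. apply: compact_closed; [exact: plane_hausdorff|exact: compact_set1]. Qed.

Lemma drawing_sep x : ~ drawing G x ->
  exists2 d, 0 < d & forall q, drawing G q -> ~ dclose d x q.
Proof.
move=> nx.
have [d1 d10 h1] : exists2 d, 0 < d & forall w, ~ dclose d x (pos G w).
  apply: fin_eps => [w d d' dd h /(dclose_le dd) //|w].
  have [|d d0 h] := @closed_sep _ x [set pos G w] (@pos_closed w).
    by move=> /= xw; apply: nx; left; exists w.
  by exists d => //; apply: h.
have [d2 d20 h2] : exists2 d, 0 < d & forall uv : V * V, adj G uv.1 uv.2 ->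
    forall q, edge_curve G uv.1 uv.2 q -> ~ dclose d x q.
  apply: fin_eps => [[u v] d d' dd h uv q cq /(dclose_le dd)|[u v] /=].
    exact: h.
  case: (boolP (adj G u v)) => uv; last by exists 1.
  have [|d d0 h] := closed_sep (curve_closed uv) (x := x); last by exists d.
  by move=> cx; apply: nx; right; exists u, v.
exists (Num.min d1 d2); first by rewrite lt_min d10.
move=> q [[w _ <-]|[u [v [uv cq]]]] h.
  by apply: (h1 w); apply: dclose_le h; rewrite ge_min lexx.
by apply: (h2 (u, v) uv q cq); apply: dclose_le h; rewrite ge_min lexx orbT.
Qed.

Lemma drawing_bounded : exists M, forall q, drawing G q -> `|q| <= M.
Proof.
have curveB (uv : V * V) : exists M, adj G uv.1 uv.2 ->
    forall q, edge_curve G uv.1 uv.2 q -> `|q| <= M.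
  case: uv => u v /=; case: (boolP (adj G u v)) => uv; last by exists 0.
  have [M [_ hM]] := compact_bounded (arc_compact (curve_arc uv)).
  by exists (M + 1) => _ q cq; apply: hM => //; rewrite ltrDl.
have [f hf] := choice curveB.
exists (\sum_uv `|f uv| + \sum_w `|pos G w|) => q [[w _ <-]|[u [v [uv cq]]]].
  rewrite (bigD1 w) //= addrCA lerDl addr_ge0 //; first exact: sumr_ge0.
  exact: sumr_ge0.
apply: le_trans (hf (u, v) uv q cq) _; apply: le_trans (ler_norm _) _.
rewrite (bigD1 (u, v)) //= -addrA lerDl addr_ge0 //; first exact: sumr_ge0.
exact: sumr_ge0.
Qed.

Definition margin eta : set (R * R) :=
  [set p | forall q, drawing G q -> ~ dclose eta p q].

(** The margin is chosen before the step [d], because the step is fixed last, in terms of all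
    margins. *)
Definition linked x y :=
  exists2 eta, 0 < eta & forall d, 0 < d -> reach (margin eta) d x y.

Lemma margin_le eta eta' : eta' <= eta -> margin eta `<=` margin eta'.
Proof. by move=> h p mp q dq /(dclose_le h); apply: mp. Qed.

Lemma linked_sym x y : linked x y -> linked y x.
Proof. by move=> [eta e0 h]; exists eta => // d /h /reach_sym. Qed.

Lemma linked_trans x y z : linked x y -> linked y z -> linked x z.
Proof.
move=> [e1 e10 h1] [e2 e20 h2]; exists (Num.min e1 e2); first by rewrite lt_min e10.
move=> d d0; apply: (@reach_trans _ _ _ _ y).
  by apply: reach_sub (h1 d d0); apply: margin_le; rewrite ge_min lexx.
by apply: reach_sub (h2 d d0); apply: margin_le; rewrite ge_min lexx orbT.
Qed.

Lemma linked_segment eta x y : 0 < eta ->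
  (forall t, 0 <= t <= 1 -> margin eta (x + t *: (y - x))) -> linked x y.
Proof. by move=> e0 h; exists eta => // d d0; apply: segment_reach. Qed.

Lemma dclose_segment d x y t : 0 <= t <= 1 -> dclose d x y ->
  dclose d x (y + t *: (x - y)).
Proof.
have aux (a b : R) : 0 <= t <= 1 -> `|a - b| < d -> `|a - (b + t * (a - b))| < d.
  move=> /andP[t0 t1]; apply: le_lt_trans.
  have -> : a - (b + t * (a - b)) = (1 - t) * (a - b) by lra.
  by rewrite normrM ger0_norm ?subr_ge0 // ler_piMl // lerBlDr lerDl.
by move=> ht /andP[h1 h2]; apply/andP; split; apply: aux.
Qed.

Lemma linked_local x : ~ drawing G x ->
  exists2 d, 0 < d & forall y, dclose d x y -> linked x y.
Proof.
move=> /drawing_sep[d d0 h]; exists (d / 2); first by lra.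
move=> y xy; apply: linked_sym; apply: (@linked_segment (d / 2)); first by lra.
move=> t ht q dq pq; apply: (h q dq).
by have := dclose_trans (dclose_segment ht xy) pq; rewrite -splitr.
Qed.

Lemma linked_component x y : ~ drawing G x ->
  connected_component (~` drawing G) x y -> linked x y.
Proof.
move=> nx cy; apply: (connected_equiv (K := connected_component (~` drawing G) x)).
- exact: component_connected.
- exact: linked_sym.
- exact: linked_trans.
- move=> u /connected_component_sub /linked_local[d d0 h]; exists d => // v _; exact: h.
- exact: connected_component_refl.
- exact: cy.
Qed.

(** Outside a box around the drawing, at most two axis-parallel segments lead to a fixed corner at a
    positive distance from the drawing. This joins all unbounded components, so the outer face
    behaves as one. *)
Lemma linked_far : exists (M : R) (c : R * R), forall x, M < `|x| -> linked x c.
Proof.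
have [M hM] := drawing_bounded.
have hM1 q : drawing G q -> `|q.1| <= M.
  by move=> /hM; apply: le_trans; rewrite prod_normE le_max lexx.
have hM2 q : drawing G q -> `|q.2| <= M.
  by move=> /hM; apply: le_trans; rewrite prod_normE le_max lexx orbT.
have vert (a b b' : R) : M < `|a| -> linked (a, b) (a, b').
  move=> Ma; apply: (@linked_segment (`|a| - M)); first by rewrite subr_gt0.
  move=> t _ q /hM1 dq /andP[/= + _]; rewrite subrr scaler0 addr0 => h.
  by have := ler_distD q.1 a 0; rewrite !subr0; lra.
have horz (a a' b : R) : M < `|b| -> linked (a, b) (a', b).
  move=> Mb; apply: (@linked_segment (`|b| - M)); first by rewrite subr_gt0.
  move=> t _ q /hM2 dq /andP[/= _]; rewrite subrr scaler0 addr0 => h.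
  by have := ler_distD q.2 b 0; rewrite !subr0; lra.
have M1 : M < `|M + 1| by apply: lt_le_trans (ler_norm _); rewrite ltrDl.
exists M, (M + 1, M + 1) => -[a b]; rewrite prod_normE lt_max /= => /orP[h|h].
  by apply: linked_trans (vert a b (M + 1) h) _; apply: horz.
by apply: linked_trans (horz a (M + 1) b h) _; apply: vert.
Qed.

Lemma linked_outer x y : outer_face G x -> outer_face G y -> linked x y.
Proof.
have [M [c hc]] := linked_far.
suff h z : outer_face G z -> linked z c.
  by move=> /h xc /h yc; apply: linked_trans xc (linked_sym yc).
move=> [nz nb]; have [w [cw Mw]] : exists w : R * R,
    connected_component (~` drawing G) z w /\ M < `|w|.
  apply: contrapT => nw; apply: nb; exists M; split=> [|N MN w cw] /=.
    exact: num_real.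
  rewrite leNgt; apply/negP => Nw; apply: nw; exists w; split=> //.
  exact: lt_trans Nw.
by apply: linked_trans (linked_component nz cw) (hc _ Mw).
Qed.

(** Being in the closure only provides points of the outer face near [pos G v]. The last piece of
    the chain is a straight segment inside the [rho]-square of the vertex, where it may meet the
    drawing. *)
Lemma boundary_reach z v rho : outer_face G z -> boundary_vertex G v -> 0 < rho ->
  exists2 eta, 0 < eta & forall d, 0 < d ->
    reach (margin eta `|` [set p | dclose rho (pos G v) p]) d z (pos G v).
Proof.
move=> oz bv r0.
have [v' [ov' vv']] : outer_face G `&` [set p | dclose rho (pos G v) p] !=set0.
  by apply: bv; apply/nbhs_dcloseP; exists rho.
have [eta e0 h] := linked_outer oz ov'; exists eta => // d d0.
apply: (@reach_trans _ _ _ _ v').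
  by apply: reach_sub (h d d0); left.
apply: segment_reach => // t ht; right; exact: dclose_segment.
Qed.

(* [None] is a vertex placed at a point of the outer face and joined to all
   boundary vertices. *)
Definition outer_adj (a b : option V) : bool :=
  match a, b with
  | Some u, Some v => adj G u v
  | None, Some v | Some v, None => `[< boundary_vertex G v >]
  | None, None => false
  end.

Lemma outer_adj_sym : symmetric outer_adj.
Proof. by move=> [u|] [v|] //=; rewrite adj_sym. Qed.

Lemma outer_adj_irr : irreflexive outer_adj.
Proof. by move=> [u|] //=; rewrite adj_irr. Qed.

(** The order of choices matters: [rho v] keeps clear of the edges not ending at [v], [eta v] is the
    margin on the way from [z] to the [rho v]-square, and [eps] separates all pairs of disjoint
    edges at once. Steps of [eps / 2] make far mean [eps]. *)
Lemma outer_drawing z : outer_face G z ->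
  exists d (ps : option V -> R * R) (chain : option V -> option V -> seq (R * R)),
  [/\ injective ps,
      forall a b, outer_adj a b ->
        path (dclose d) (ps a) (chain a b) /\ last (ps a) (chain a b) = ps b
    & forall a b a' b', outer_adj a b -> outer_adj a' b' ->
        a != a' -> a != b' -> b != a' -> b != b' ->
        {in ps a :: chain a b & ps a' :: chain a' b', forall p q, dfar d p q}].
Proof.
move=> oz.
pose ps (a : option V) := if a is Some v then pos G v else z.
(* The double radius leaves a gap [rho] between the square around [v] and the curve. *)
have vertex_sep v : exists2 rho, 0 < rho & forall uw : V * V, adj G uw.1 uw.2 ->
    v != uw.1 -> v != uw.2 ->
    forall q, edge_curve G uw.1 uw.2 q -> ~ dclose (rho + rho) (pos G v) q.
  apply: fin_eps => [[u w] d d' dd h uw vu vw q cq|[u w] /=].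
    have dd2 : d' + d' <= d + d by lra.
    by move=> /(dclose_le dd2); apply: h cq.
  have [/and3P[uw vu vw]|nuw] := boolP [&& adj G u w, v != u & v != w]; last first.
    by exists 1 => // uw vu vw; rewrite uw vu vw in nuw.
  have [|d d0 h] := closed_sep (curve_closed uw) (x := pos G v).
    by move=> /(curve_vertex uw)[] e; rewrite e eqxx in vu vw.
  by exists (d / 2); [lra|rewrite -splitr].
have /choice[rho hrho] : forall v, exists r, 0 < r /\ forall uw : V * V,
    adj G uw.1 uw.2 -> v != uw.1 -> v != uw.2 ->
    forall q, edge_curve G uw.1 uw.2 q -> ~ dclose (r + r) (pos G v) q.
  by move=> v; have [r] := vertex_sep v; exists r.
have /choice[eta heta] : forall v, exists e, boundary_vertex G v -> 0 < e /\
    forall d, 0 < d ->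
    reach (margin e `|` [set p | dclose (rho v) (pos G v) p]) d z (pos G v).
  move=> v; case: (pselect (boundary_vertex G v)) => bv; last by exists 0.
  by have [e] := boundary_reach oz bv (hrho v).1; exists e.
(* For an edge at [None] this is a region, not a curve: it holds chains of every step, so it can be
   fixed before [eps]. *)
pose K (a b : option V) : set (R * R) :=
  match a, b with
  | Some u, Some v => edge_curve G u v
  | None, Some v | Some v, None =>
      margin (eta v) `|` [set p | dclose (rho v) (pos G v) p]
  | None, None => set0
  end.
have K_reach a b d : 0 < d -> outer_adj a b -> reach (K a b) d (ps a) (ps b).
  move=> d0; case: a b => [u|] [v|] //= h.
  - have [cu cv] := arc_ends (curve_arc h).
    exact: connected_reach (arc_connected (curve_arc h)) cu cv.
  - by move/asboolP: h => /heta[_ h]; apply: reach_sym; apply: h.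
  - by move/asboolP: h => /heta[_ h]; apply: h.
have vsep v u w : boundary_vertex G v -> adj G u w -> v != u -> v != w ->
    exists2 d, 0 < d & forall p q,
      (margin (eta v) `|` [set p | dclose (rho v) (pos G v) p]) p ->
      edge_curve G u w q -> ~ dclose d p q.
  move=> bv uw vu vw; have [e0 _] := heta v bv; have [r0 hr] := hrho v.
  exists (Num.min (eta v) (rho v)); first by rewrite lt_min e0.
  move=> p q [mp|pv] cq pq.
    apply: (mp q); first by right; exists u, w.
    by apply: dclose_le pq; rewrite ge_min lexx.
  apply: (hr (u, w) uw vu vw q cq); apply: dclose_trans pv _.
  by apply: dclose_le pq; rewrite ge_min lexx orbT.
have K_sep (f : (option V * option V) * (option V * option V)) :
    exists2 d, 0 < d & outer_adj f.1.1 f.1.2 -> outer_adj f.2.1 f.2.2 ->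
    f.1.1 != f.2.1 -> f.1.1 != f.2.2 -> f.1.2 != f.2.1 -> f.1.2 != f.2.2 ->
    forall p q, K f.1.1 f.1.2 p -> K f.2.1 f.2.2 q -> ~ dclose d p q.
  case: f => -[a b] [a' b'] /=.
  have [/and3P[ab ab' /and4P[n1 n2 n3 n4]]|n] := boolP [&& outer_adj a b,
      outer_adj a' b' & [&& a != a', a != b', b != a' & b != b']]; last first.
    by exists 1 => // h1 h2 h3 h4 h5 h6; rewrite h1 h2 h3 h4 h5 h6 in n.
  suff [d d0 h] : exists2 d, 0 < d & forall p q, K a b p -> K a' b' q -> ~ dclose d p q.
    by exists d.
  have bP v : `[< boundary_vertex G v >] -> boundary_vertex G v by move/asboolP.
  have ne (s t : V) : Some s != Some t -> t != s by rewrite eq_sym.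
  have sw (d : R) (A B : set (R * R)) :
      (forall p q, A p -> B q -> ~ dclose d p q) ->
      forall p q, B p -> A q -> ~ dclose d p q.
    by move=> h p q Bp Aq; rewrite dcloseC; apply: h.
  (* Two edges at [None] share an end, so at most one of the two sets is a region. *)
  case: a b a' b' ab ab' n1 n2 n3 n4 => [u|] [v|] [u'|] [v'|] //= ab ab' n1 n2 n3 n4.
  - apply: compact_sep.
    + exact: arc_compact (curve_arc ab).
    + exact: curve_closed.
    apply/seteqP; split=> // p [pc pc'].
    have [w _ ew] : range (pos G) p.
      apply: (curve_disjoint ab ab'); last by split.
        by case=> e1 e2; rewrite e1 eqxx in n1.
      by case=> e1 e2; rewrite e1 eqxx in n2.
    rewrite -ew in pc pc'.
    by case: (curve_vertex ab pc) (curve_vertex ab' pc') => -> [] e;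
      move: n1 n2 n3 n4; rewrite e eqxx.
  - have [d d0 h] := vsep u' u v (bP _ ab') ab (ne _ _ n1) (ne _ _ n3).
    by exists d => //; apply: sw.
  - have [d d0 h] := vsep v' u v (bP _ ab') ab (ne _ _ n2) (ne _ _ n4).
    by exists d => //; apply: sw.
  - exact: (vsep u u' v' (bP _ ab) ab' n1 n2).
  - exact: (vsep v u' v' (bP _ ab) ab' n3 n4).
have [eps e0 sep] : exists2 d, 0 < d &
    forall f : (option V * option V) * (option V * option V),
    outer_adj f.1.1 f.1.2 -> outer_adj f.2.1 f.2.2 ->
    f.1.1 != f.2.1 -> f.1.1 != f.2.2 -> f.1.2 != f.2.1 -> f.1.2 != f.2.2 ->
    forall p q, K f.1.1 f.1.2 p -> K f.2.1 f.2.2 q -> ~ dclose d p q.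
  apply: fin_eps => // f d d' dd h h1 h2 h3 h4 h5 h6 p q Kp Kq /(dclose_le dd).
  exact: h.
have d0 : 0 < eps / 2 by lra.
have /choice[chain hc] : forall ab : option V * option V, exists s, outer_adj ab.1 ab.2 ->
    [/\ path (dclose (eps / 2)) (ps ab.1) s, last (ps ab.1) s = ps ab.2
      & forall p, p \in ps ab.1 :: s -> K ab.1 ab.2 p].
  move=> -[a b] /=; case: (boolP (outer_adj a b)) => ab; last by exists [::].
  by have [s hs] := K_reach a b _ d0 ab; exists s.
exists (eps / 2), ps, (fun a b => chain (a, b)); split.
- have [nz _] := oz; move=> [u|] [v|] //=.
  + by move/(@pos_inj _ _ G) => ->.
  + by move=> e; case: nz; left; exists u.
  + by move=> e; case: nz; left; exists v.
- by move=> a b ab; have [] := hc (a, b) ab.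
move=> a b a' b' ab ab' n1 n2 n3 n4 p q pc qc.
have [_ _ h] := hc (a, b) ab; have [_ _ h'] := hc (a', b') ab'.
have := sep ((a, b), (a', b')) ab ab' n1 n2 n3 n4 p q (h _ pc) (h' _ qc).
move=> /negP; rewrite /dclose negb_and -!leNgt.
by rewrite /dfar mulrC divfK ?pnatr_eq0.
Qed.

End OuterFace.

(** * Removing the added vertex [None] *)

Section OptionTransfer.
Variable V : finType.

Definition somes (L : seq (V * V)) := [seq (Some p.1, Some p.2) | p <- L].

Lemma coef_somes L (eta : option V -> nat) :
  eta None = 0 -> coef (somes L) eta = coef L (fun v => eta (Some v)).
Proof.
elim: L eta => [|[u v] s IH] eta e0 /=.
  congr (nat_of_bool _)%:R%R; apply/forallP/forallP => [h x|h [x|]] //.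
  by rewrite e0.
by rewrite !IH /decr ?e0 ?sub0n.
Qed.

Lemma edge_list_somes (r : rel (option V)) L : edge_list r L ->
    (forall a b, r a b -> a != None /\ b != None) ->
  exists2 L', L = somes L' & edge_list (fun u v => r (Some u) (Some v)) L'.
Proof.
move=> [uL aL eL] hr.
have [L' eL'] : exists L', L = somes L'.
  have hL p : p \in L -> p.1 != None /\ p.2 != None.
    by case: p => a b ab; apply: hr; rewrite eL ab.
  elim: L hL {uL aL eL} => [|[[u|] [v|]] s IH] hL.
  - by exists [::].
  - have [|L' ->] := IH; first by move=> p ps; apply: hL; rewrite inE ps orbT.
    by exists ((u, v) :: L').
  - by have [] := hL _ (mem_head _ _).
  - by have [] := hL _ (mem_head _ _).
  - by have [] := hL _ (mem_head _ _).
exists L' => //; subst L.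
have inj : injective (fun p : V * V => (Some p.1, Some p.2)).
  by move=> [a b] [c d] [-> ->].
have mem u v : ((Some u, Some v) \in somes L') = ((u, v) \in L').
  exact: (mem_map inj L' (u, v)).
split=> [|u v|u v].
- by rewrite -(map_inj_uniq inj).
- by rewrite -!mem; apply: aL.
- by rewrite eL !mem.
Qed.

End OptionTransfer.

Theorem theorem3 (R : realType) (d : Order.disp_t) (V : finOrderType d)
    (G : plane_graph R V) (v1 v2 : V) (he : boundary_edge G v1 v2) :
  exists eta : V -> nat,
    graph_coef (del_edge (adj G) v1 v2) eta <> 0%R /\
    eta v1 = 0 /\ eta v2 = 0 /\
    (forall v : V, boundary_vertex G v -> v <> v1 -> v <> v2 -> eta v <= 2) /\
    (forall v : V, interior_vertex G v -> eta v <= 4).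
Proof.
have [e12 cB] := he.
have [c1 c2] := arc_ends (curve_arc e12).
have [bv1 bv2] : boundary_vertex G v1 /\ boundary_vertex G v2 by split; apply: cB.
(* The outer face has [v1] in its closure, so it contains a point at which to place [None]. *)
have [z [oz _]] : (outer_face G `&` setT !=set0)%classic.
  by apply: bv1; apply: filterT.
have [delta [ps [chain [psI chP chF]]]] := outer_drawing oz.
have eC := outer_adj_sym G; have eirr := outer_adj_irr G.
have noK5 := no_K5_model eC psI chP chF.
have noK33 := no_K33_model eC psI chP chF.
pose S : {set option V} := [set~ None].
have inS v : Some v \in S by rewrite !inE.
have inB v : boundary_vertex G v -> Some v \in bd (outer_adj G) [set None] S.
  by move=> bv; rewrite inE inS nbhd1; apply/asboolP.
have dZ : [disjoint [set None] & S]%B by rewrite disjoints1 !inE eqxx.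
have [h _ _] := nice_exists eC eirr noK5 noK33 (leqnn #|S|) (conn1 eC None) dZ.
have [eta [L [[eL nz b2 b4 b0] e1 e2]]] := h _ _ (inB _ bv1) (inB _ bv2) e12.
have [|L' eL' hL'] := edge_list_somes eL.
  by move=> a b /del_edge_inS /andP[]; rewrite !inE.
have e0 : eta None = 0 by apply: b0; rewrite !inE eqxx.
exists (fun v => eta (Some v)); split; last first.
  split; first exact: e1.
  split; first exact: e2.
  by split=> [v /inB /b2 //|v _]; apply: b4.
have eqr : (fun u v => del_edge (restr (outer_adj G) S) (Some v1) (Some v2) (Some u) (Some v))
    = del_edge (adj G) v1 v2.
  by apply: funext => u; apply: funext => v; rewrite /del_edge /restr !inS.
rewrite eqr in hL'; apply: (graph_coef_neq0 hL').
by rewrite -coef_somes // -eL'.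
Qed.
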